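(* Let $\alpha\ge 0$ and $q\in(0,1)$. If $(P_\alpha)$ has a solution $u$ such that $u>0$ in $\Omega_+^a$, then $\int_\Omega a<0$. If, in addition, $\Omega_+^a$ has finitely many connected components, all of which are smooth, and $q\in\mathcal{I}_{\mathcal N}$, then every such solution belongs to $\mathcal P^\circ$.
   Context: Let $\Omega\subset\mathbb{R}^N$ ($N\ge1$) be a bounded domain with smooth boundary, $\nu$ the unit outward normal and $\partial_\nu$ the outward normal derivative. Let $0<\theta<1$ and let $a\in C^\theta(\overline\Omega)$ change sign in $\Omega$. For $\alpha\ge0$ and $q\in(0,1)$, $(P_\alpha)$ denotes the problem $-\Delta u=a(x)u^q$ in $\Omega$, $u\ge0$ in $\Omega$, $\partial_\nu u=\alpha u$ on $\partial\Omega$. A solution of $(P_\alpha)$ is a nonnegative classical solution $u\in C^{2+r}(\overline\Omega)$ for some $r\in(0,1)$. $\Omega_+^a:=\{x\in\Omega: a(x)>0\}$, and $\mathcal P^\circ:=\{u\in C(\overline\Omega): u>0 \text{ on } \overline\Omega\}$. $\mathcal I_{\mathcal N}$ denotes the set of $q\in(0,1)$ for which $(P_0)$ has a solution in $\mathcal P^\circ$. *)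

(* Defs.v *)
From HB Require Import structures.
From mathcomp Require Import all_boot all_order all_algebra.
From mathcomp Require Import all_classical all_reals all_analysis.
Set Implicit Arguments. Unset Strict Implicit. Unset Printing Implicit Defensive.
Import Order.TTheory GRing.Theory Num.Theory.
Import numFieldNormedType.Exports.
Local Open Scope classical_set_scope.
Local Open Scope ring_scope.

Section Defs.
Variables (R : realType) (N : nat).
Notation V := 'rV[R]_N.

Definition evec (i : 'I_N) : V := delta_mx 0 i.
Definition coord (x : V) (i : 'I_N) : R := x 0 i.

Definition partial (i : 'I_N) (f : V -> R) : V -> R := fun x => 'D_(evec i) f x.

Fixpoint iter_partial (l : seq 'I_N) (f : V -> R) : V -> R :=
  if l is i :: l' then partial i (iter_partial l' f) else f.

Definition smooth_on (U : set V) (f : V -> R) : Prop :=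
  forall (l : seq 'I_N) (x : V), U x ->
    {for x, continuous (iter_partial l f)} /\
    forall i, derivable (iter_partial l f) x (evec i).

Definition boundary (O : set V) : set V := closure O `\` O.

Definition local_defining (O : set V) (x0 : V) (r : R) (phi : V -> R) : Prop :=
  0 < r /\ smooth_on (ball x0 r) phi /\
  (exists i, partial i phi x0 != 0) /\
  forall x, ball x0 r x -> (O x <-> phi x < 0).

Definition smooth_domain (O : set V) : Prop :=
  open O /\ O !=set0 /\ connected O /\ bounded_set O /\
  forall x0, boundary O x0 -> exists r phi, local_defining O x0 r phi.

Definition holder_on (t : R) (D : set V) (f : V -> R) : Prop :=
  exists C : R, forall x y, D x -> D y -> `|f x - f y| <= C * powR `|x - y| t.

(* Nonnegative classical solution of (P_alpha), u in C^{2+r}(closure O)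
   for some r in (0,1).  Du i and D2u i j are the (continuous extensions to
   the closure of the) first and second partial derivatives of u. *)
Definition solution (O : set V) (a : V -> R) (q alpha : R) (u : V -> R) : Prop :=
  exists (r : R) (Du : 'I_N -> V -> R) (D2u : 'I_N -> 'I_N -> V -> R),
    0 < r < 1 /\
        {within closure O, continuous u} /\
        (forall i, {within closure O, continuous Du i}) /\
        (forall i j, {within closure O, continuous D2u i j}
                     /\ holder_on r O (D2u i j)) /\
        (forall x, O x -> forall i,
            derivable u x (evec i) /\ partial i u x = Du i x /\
            forall j, derivable (Du i) x (evec j) /\ partial j (Du i) x = D2u i j x) /\
        (forall x, O x -> 0 <= u x) /\
        (forall x, O x -> - (\sum_i D2u i i x) = a x * powR (u x) q) /\
        (* Robin boundary condition  d_nu u = alpha u, with outward unit normal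
           nu(x0) = grad phi(x0) / |grad phi(x0)| for a local defining function phi *)
        (forall x0 r0 phi, boundary O x0 -> local_defining O x0 r0 phi ->
            \sum_i Du i x0 * partial i phi x0
              = alpha * u x0 * Num.sqrt (\sum_i (partial i phi x0) ^+ 2)).

Definition pos_part (O : set V) (a : V -> R) : set V := [set x | O x /\ 0 < a x].

Definition positive_on_closure (O : set V) (u : V -> R) : Prop :=
  forall x, closure O x -> 0 < u x.

Definition I_N (O : set V) (a : V -> R) : set R :=
  [set q | 0 < q < 1 /\ exists v, solution O a q 0 v /\ positive_on_closure O v].

Definition components (A : set V) : set (set V) :=
  [set C | exists x, A x /\ C = connected_component A x].

(* dyadic Riemann sum of f * 1_O over the box [-M, M)^N, mesh 2^-k *)
Definition dyadic_sum (O : set V) (f : V -> R) (M k : nat) : R :=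
  \sum_(z : {ffun 'I_N -> 'I_(2 * M * 2 ^ k)})
     (let x : V := \row_i (((z i : nat)%:R / (2 ^ k)%:R) - M%:R) in
      \1_O x * f x) / ((2 ^ k)%:R ^+ N).

(* integral of f over O, for any M with O inside [-M, M]^N *)
Definition integral_over (O : set V) (f : V -> R) (M : nat) : R :=
  limn (dyadic_sum O f M).

Definition in_box (O : set V) (M : nat) : Prop :=
  forall x i, O x -> - M%:R <= coord x i <= M%:R.

End Defs.

(* Main.v *)
(** Every integral is a limit of dyadic Riemann sums, and the only analytic tool
    is the inequality [int div F >= 0] for a C^1 field [F] with outward flux. It
    holds because the difference quotients of a compactly supported function sum
    to zero over the grid, and because the grid points near a smooth boundary
    have density proportional to the width of the strip.

    Part 1: apply it to [F = (u + e)^(-q) grad u]. Up to the defect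
    [a (1 - (u / (u + e))^q)], whose positive part vanishes as [e -> 0] since
    [u > 0] where [a > 0], this gives [int a <= - q int (u + 1)^(-q-1) |grad u|^2],
    and the last integral is positive.

    Part 2: let [v > 0] solve the Neumann problem, and put
    [w(s) = s^(1-q) / (1-q)], which turns the equation into
    [- Lap w = a + q/(1-q) |grad w|^2 / w]. Testing with an increasing function
    [psi] of [d = w(v) - w(u + e)] supported in [d > m0] shows that both gradients
    vanish where [d > m0]; there the quadratic terms have a sign because
    [w(v) - w(u + e)] is bounded below. If [u < v] somewhere, then [u] and [v] are
    constant by connectedness, so [a = 0], which is absurd. Hence [u >= v > 0]. *)

Require Import Defs.
From HB Require Import structures.
From mathcomp Require Import all_boot all_order all_algebra.
From mathcomp Require Import all_classical all_reals all_analysis.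
From mathcomp Require Import ring lra zify.
Set Implicit Arguments.
Unset Strict Implicit.
Unset Printing Implicit Defensive.

Import Order.TTheory GRing.Theory Num.Theory.
Import numFieldNormedType.Exports.
Local Open Scope classical_set_scope.
Local Open Scope ring_scope.

(** Only the sign of the boundary flux is ever used, so a one-sided divergence inequality suffices.
    This avoids surface measure and flattening of the boundary: near a boundary point the field is
    cut off along the level sets of a defining function, and the cost is a count of grid points in
    thin layers. A solution may vanish on part of the domain, where [u^(-q)] is singular. The shift
    by [e] restores positivity, and its price is the factor [(u / (u + e))^q] in front of [a]. In
    the comparison, subtracting the transformed equations cancels [a] up to that defect, although
    [a] changes sign. There remains [q (P^2 / A - Q^2 / B)] with [P], [Q] the two gradients,
    [A = v^(1-q)] and [B = (u + e)^(1-q)]. A gap [A - B >= m] bounds it by a multiple of [(P - Q)^2]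
    minus a multiple of [P^2]. An exponential factor in [psi], giving [psi' >= lam psi], absorbs the
    first; the second is what forces both gradients to vanish. Since [e] tends to 0 only after the
    mesh does, strictness is kept by a lower bound [c] for the Riemann sums of a function that does
    not involve the small parameter: [c] is fixed first, then [e], then the mesh. *)

Section Compactness.
Variables (R : realType) (N : nat).
Notation V := 'rV[R]_N.
Implicit Types (x y : V) (A : set V).

(* The complements of the sets with property [P] form a filter; a cluster
   point of it contradicts the local hypothesis. *)
Lemma compact_ind (T : topologicalType) (A : set T) (P : set T -> Prop) :
  compact A -> (forall B C, B `<=` C -> P C -> P B) ->
  P set0 -> (forall B C, P B -> P C -> P (B `|` C)) ->
  (forall z, A z -> exists2 U, nbhs z U & P U) -> P A.
Proof.
move=> cA Psub P0 PU loc; apply: contrapT => nPA.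
pose F := [set B | P (A `\` B)].
have FF : ProperFilter F.
  apply: Build_ProperFilter_ex.
    move=> B FB; apply: contrapT => nB; apply: nPA.
    by apply: Psub FB => t At; split => // Bt; apply: nB; exists t.
  split.
  - by rewrite /F /= setDT.
  - move=> B C FB FC; apply: Psub (PU _ _ FB FC) => t [At nBC].
    have [Bt|nBt] := pselect (B t); last by left.
    by right; split => // Ct; exact: nBC.
  - by move=> B C BC; apply: Psub => t [At nC]; split => // /BC.
have FA : F A by rewrite /F /= setDv.
have [x [Ax xF]] := cA F FF FA.
have [U nU PU'] := loc x Ax.
have FAU : F (A `\` U).
  by apply: Psub PU' => t [At nAU]; apply: contrapT => nUt; exact: nAU.
by have [t [[_ nUt] Ut]] := xF _ _ FAU nU.
Qed.

(** Row vectors carry the maximum norm, so balls are cubes along the axes: grid points in a ball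
    form a product, and axis-parallel segments between points of a ball stay in it. The condition
    [0 < r] matters for [N = 0], where the maximum is empty. *)
Lemma row_norm_lt x (r : R) : 0 < r -> (`|x| < r) = [forall i, `|x 0 i| < r].
Proof.
move=> r0; apply/idP/forallP => [xr i|xr].
  apply: le_lt_trans xr; rewrite {2}/Num.norm /= mx_normrE.
  exact: (le_bigmax _ (fun ij : 'I_1 * 'I_N => `|x ij.1 ij.2|) (0, i)).
rewrite /Num.norm /= mx_normrE; apply/bigmax_ltP; split => // -[i j] _ /=.
by rewrite (ord1 i).
Qed.

Lemma coord_le_norm x i : `|x 0 i| <= `|x|.
Proof.
rewrite {2}/Num.norm /= mx_normrE.
exact: (le_bigmax _ (fun ij : 'I_1 * 'I_N => `|x ij.1 ij.2|) (0, i)).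
Qed.

Lemma row_norm_le x (r : R) : 0 <= r -> (forall i, `|x 0 i| <= r) -> `|x| <= r.
Proof.
move=> r0 xr; rewrite /Num.norm /= mx_normrE; apply/bigmax_leP; split => //.
by move=> [i j] _ /=; rewrite (ord1 i).
Qed.

Lemma evecE (i j : 'I_N) : evec R i 0 j = (i == j)%:R.
Proof. by rewrite /evec mxE eqxx eq_sym. Qed.

Lemma norm_evec (i : 'I_N) (t : R) : `|t *: evec R i| = `|t|.
Proof.
apply/eqP; rewrite eq_le row_norm_le //=; last first.
  move=> j; rewrite mxE evecE; case: eqP => _; rewrite ?mulr1 ?mulr0 ?normr0 //.
have := coord_le_norm (t *: evec R i) i.
by rewrite mxE evecE eqxx mulr1.
Qed.

Lemma near_ballP (P : set V) x :
  nbhs x P <-> exists2 r : R, 0 < r & forall y, `|x - y| < r -> P y.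
Proof.
split=> [/nbhs_ballP [r /= r0 rP]|[r r0 rP]].
  by exists r => // y xy; apply: rP; rewrite -ball_normE.
by apply/nbhs_ballP; exists r => // y; rewrite -ball_normE; exact: rP.
Qed.

End Compactness.

(** * Derivatives along lines *)

Section Lines.
Variables (R : realType) (N : nat).
Notation V := 'rV[R]_N.
Implicit Types (x y v : V) (f : V -> R).

(** Both difference quotients are the same function of [h]. The chain rule and the mean value
    theorem of one real variable thereby apply to directional derivatives. *)
Lemma is_derive_line f x v (t df : R) :
  is_derive (t *: v + x) v f df <->
  is_derive t 1 (fun s => f (s *: v + x)) df.
Proof.
have E : (fun h : R => h^-1 *: (f (h *: v + (t *: v + x)) - f (t *: v + x)))
   = (fun h : R => h^-1 *: ((fun s => f (s *: v + x)) (h *: 1 + t)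
                      - (fun s => f (s *: v + x)) t)).
  by apply/funext => h /=; rewrite scalerDl addrA [h *: 1]mulr1.
split=> -[d1 d2]; constructor.
- by rewrite /derivable -E.
- by rewrite /derive -E.
- by rewrite /derivable E.
- by rewrite /derive E.
Qed.

Lemma is_derive_comp1 (g : R -> R) f x v (dg df : R) :
  is_derive (f x) 1 g dg -> is_derive x v f df ->
  is_derive x v (g \o f) (dg * df).
Proof.
move=> gg ff.
have E : 0 *: v + x = x by rewrite scale0r add0r.
rewrite -{1}E; apply/is_derive_line.
apply: (@is_derive1_comp _ g (fun s => f (s *: v + x))); rewrite ?E //.
by apply/is_derive_line; rewrite E.
Qed.

Lemma line_mvt f (df : V -> R) x v (h : R) : 0 <= h ->
  (forall t, 0 <= t <= h -> is_derive (t *: v + x) v f (df (t *: v + x))) ->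
  exists2 t, 0 <= t <= h & f (h *: v + x) - f x = df (t *: v + x) * h.
Proof.
move=> h0 fd.
have fd' t : 0 <= t <= h -> is_derive t 1 (fun s => f (s *: v + x)) (df (t *: v + x)).
  by move=> th; apply/is_derive_line/fd.
have [| |t] := @MVT_segment R (fun s => f (s *: v + x))
    (fun s => df (s *: v + x)) 0 h h0.
- by move=> t; rewrite in_itv /= => /andP[t0 th]; apply: fd'; rewrite !ltW.
- apply/subspace_continuousP => t /=; rewrite in_itv /= => th.
  apply: cvg_within_filter; apply: differentiable_continuous.
  by apply/derivable1_diffP; case: (fd' t th).
- rewrite in_itv /= subr0 scale0r add0r => th E; by exists t.
Qed.

End Lines.

(** * Uniform continuity and boundedness on compact sets *)

Section UniformContinuity.
Variables (R : realType) (N : nat).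
Notation V := 'rV[R]_N.
Implicit Types (x y : V) (A D : set V) (f : V -> R).

Lemma within_cvgP A f x : f @ within A (nbhs x) --> f x <->
  forall e : R, 0 < e -> exists2 r : R, 0 < r &
    forall y, A y -> `|x - y| < r -> `|f x - f y| < e.
Proof.
split=> [fx e e0|fx].
  have /cvgrPdist_lt/(_ e e0) := fx.
  rewrite near_withinE => /near_ballP[r r0 rP]; exists r => // y Ay xy.
  exact: rP.
apply/cvgrPdist_lt => e e0; rewrite near_withinE; apply/near_ballP.
by have [r r0 rP] := fx e e0; exists r => // y xy Ay; exact: rP.
Qed.

Lemma continuousP_dist f x : {for x, continuous f} <->
  forall e : R, 0 < e -> exists2 r : R, 0 < r &
    forall y, `|x - y| < r -> `|f x - f y| < e.
Proof.
rewrite /prop_for /continuous_at.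
split=> [fx e e0|fx].
  have /(@cvgrPdist_lt _ _ _ (nbhs x) _ f (f x))/(_ e e0) := fx.
  by move=> /near_ballP.
apply/(@cvgrPdist_lt _ _ _ (nbhs x) _ f (f x)) => e e0.
by apply/near_ballP; exact: fx.
Qed.

(** Two sets let one proof serve both uses: [D = A] for continuity within a compact set, and
    [D = setT] for a function that is continuous at the points of a compact set. *)
Lemma unif_cont A D f : compact A ->
  (forall x, A x -> forall e : R, 0 < e -> exists2 r : R, 0 < r &
    forall y, D y -> `|x - y| < r -> `|f x - f y| < e) ->
  forall e : R, 0 < e -> exists2 d : R, 0 < d &
    forall x y, A x -> D x -> D y -> `|x - y| < d -> `|f x - f y| < e.
Proof.
move=> cA fc e e0.
pose P B := exists2 d : R, 0 < d &
    forall x y, B x -> D x -> D y -> `|x - y| < d -> `|f x - f y| < e.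
apply: (@compact_ind _ A P) => //.
- move=> B C BC [d d0 dP]; exists d => // x y /BC; exact: dP.
- by exists 1.
- move=> B C [d1 d10 P1] [d2 d20 P2]; exists (Num.min d1 d2).
    by rewrite lt_min d10.
  move=> x y BCx Dx Dy; rewrite lt_min => /andP[xy1 xy2].
  by case: BCx => Bx; [exact: P1|exact: P2].
- move=> z Az.
  have e2 : 0 < e / 2 by rewrite divr_gt0.
  have [r r0 rP] := fc z Az _ e2.
  have r2 : 0 < r / 2 by rewrite divr_gt0.
  exists [set x | `|z - x| < r / 2].
    by apply/near_ballP; exists (r / 2).
  exists (r / 2) => // x y /= zx Dx Dy xy.
  rewrite (splitr e).
  have -> : f x - f y = (f z - f y) - (f z - f x) by ring.
  apply: le_lt_trans (ler_normB _ _) _; apply: ltrD; apply: rP => //.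
    have -> : z - y = (z - x) + (x - y) by rewrite addrA subrK.
    by apply: le_lt_trans (ler_normD _ _) _; rewrite (splitr r) ltrD.
  by apply: lt_trans zx _; rewrite ltr_pdivrMr //; lra.
Qed.

Lemma within_unif_cont A f : compact A -> {within A, continuous f} ->
  forall e : R, 0 < e -> exists2 d : R, 0 < d &
    forall x y, A x -> A y -> `|x - y| < d -> `|f x - f y| < e.
Proof.
move=> cA /subspace_continuousP fc e e0.
have [|d d0 dP] := @unif_cont A A f cA _ e e0.
  by move=> x Ax; apply/within_cvgP/fc.
by exists d => // x y Ax Ay; exact: dP.
Qed.

Lemma ext_unif_cont A f : compact A -> continuous f ->
  (forall x, ~ A x -> f x = 0) ->
  forall e : R, 0 < e -> exists2 d : R, 0 < d &
    forall x y, `|x - y| < d -> `|f x - f y| < e.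
Proof.
move=> cA fc f0 e e0.
have [|d d0 dP] := @unif_cont A setT f cA _ e e0.
  move=> x Ax e1 e10; have /continuousP_dist/(_ _ e10)[r r0 rP] := fc x.
  by exists r => // y _; exact: rP.
exists d => // x y xy.
have [Ax|nAx] := pselect (A x); first exact: dP.
have [Ay|nAy] := pselect (A y); last by rewrite !f0 // subrr normr0.
by rewrite distrC; apply: dP => //; rewrite distrC.
Qed.

Lemma within_bounded A f : compact A -> {within A, continuous f} ->
  exists2 C : R, 0 < C & forall x, A x -> `|f x| <= C.
Proof.
move=> cA /subspace_continuousP fc.
(* The hypothesis [A x] is doubled because the compactness induction replaces only the first copy by
   a varying set. *)
suff [C C0 CP] : exists2 C : R, 0 < C & forall x, A x -> A x -> `|f x| <= C.
  by exists C => // x Ax; exact: CP.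
apply: (@compact_ind _ A (fun B => exists2 C : R, 0 < C &
   forall x, B x -> A x -> `|f x| <= C)) => //.
- by move=> B C BC [d d0 dP]; exists d => // x /BC; exact: dP.
- by exists 1.
- move=> B C [d1 d10 P1] [d2 d20 P2]; exists (Num.max d1 d2).
    by rewrite lt_max d10.
  move=> x BCx Ax; rewrite le_max.
  by case: BCx => Bx; [rewrite P1|rewrite P2 ?orbT].
- move=> z Az; have /within_cvgP/(_ 1 ltr01)[r r0 rP] := fc z Az.
  exists [set x | `|z - x| < r]; first by apply/near_ballP; exists r.
  exists (`|f z| + 1); first by rewrite ltr_wpDl.
  move=> x /= zx Ax.
  have -> : f x = f z - (f z - f x) by ring.
  by apply: le_trans (ler_normB _ _) _; rewrite lerD // ltW // rP.
Qed.

End UniformContinuity.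

(** * A continuously differentiable step function *)

Section CutoffFunctions.
Variable R : realType.
Implicit Types t h : R.

Definition relu t : R := Num.max 0 t.
Definition relu2 t : R := relu t ^+ 2.
(** A quadratic spline with knots 0, 1/2 and 1: its second derivative is 4 and then -4, so it climbs
    from 0 to 1. It is only of class C^1, which is enough since fields are differentiated once. Its
    derivative is a hat of height 2. *)
Definition smoothstep t : R :=
  2 * (relu2 t - 2 * relu2 (t - 2^-1) + relu2 (t - 1)).
Definition dsmoothstep t : R :=
  4 * (relu t - 2 * relu (t - 2^-1) + relu (t - 1)).

Lemma reluP t : (t <= 0 /\ relu t = 0) \/ (0 <= t /\ relu t = t).
Proof. by rewrite /relu; case: (leP 0 t) => h; [right|left; split => //; exact: ltW]. Qed.

Lemma relu_continuous : continuous relu.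
Proof.
move=> t; apply/cvgrPdist_lt => e e0; near=> s.
apply: (@le_lt_trans _ _ `|t - s|).
  have := ler_norm (t - s); have := ler_norm (- (t - s)); rewrite normrN.
  move: `|t - s| => n h1 h2; rewrite ler_norml.
  by case: (reluP t) (reluP s) => -[? ->] [] [? ->]; apply/andP; split; lra.
by near: s; exact: cvgr_dist_lt.
Unshelve. all: by end_near. Qed.

Lemma is_derive_relu2 t : is_derive t 1 relu2 (2 * relu t).
Proof.
(* The bound is uniform across the kink of [relu], so the difference quotient is within [|h|] of its
   limit at every [t]. *)
have bd h : `|relu2 (h + t) - relu2 t - 2 * relu t * h| <= h ^+ 2.
  rewrite /relu2 ler_norml; case: (reluP t) (reluP (h + t)) => -[? ->] [] [? ->];
    by apply/andP; split; nra.
have cv : (fun h => h^-1 *: (relu2 (h *: 1 + t) - relu2 t)) @ 0^' --> 2 * relu t.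
  apply/cvgrPdist_lt => e e0; rewrite near_withinE.
  exists e => // h /=; rewrite sub0r normrN => he h0.
  have -> : 2 * relu t - h^-1 *: (relu2 (h *: 1 + t) - relu2 t)
     = - (relu2 (h + t) - relu2 t - 2 * relu t * h) / h.
    by rewrite [h *: 1]mulr1 /GRing.scale /=; field.
  rewrite normrM normrN normfV ltr_pdivrMr ?normr_gt0 //.
  apply: le_lt_trans (bd h) _.
  by rewrite -(real_normK (num_real h)) expr2 ltr_pM2r ?normr_gt0.
constructor; first by apply/cvg_ex; exists (2 * relu t).
exact: cvg_lim cv.
Qed.

Lemma relu2_ge0 t : 0 <= relu2 t. Proof. exact: sqr_ge0. Qed.

Lemma is_derive_smoothstep t : is_derive t 1 smoothstep (dsmoothstep t).
Proof.
have sh (c : R) : is_derive t 1 (fun s => relu2 (s - c)) (2 * relu (t - c)).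
  rewrite -[X in is_derive _ _ _ X]mulr1.
  apply: (@is_derive1_comp _ relu2 (fun s => s - c)).
    exact: is_derive_relu2.
  exact: is_derive_shift.
have h0 := is_derive_relu2 t; have h1 := sh 2^-1; have h2 := sh 1.
have -> : smoothstep = 2 *: ((relu2 - 2 *: (fun s => relu2 (s - 2^-1)))
  + (fun s => relu2 (s - 1))) by [].
by apply: is_derive_eq; rewrite /dsmoothstep /GRing.scale /=; ring.
Qed.

Lemma smoothstep_continuous : continuous smoothstep.
Proof.
move=> t; apply: differentiable_continuous; apply/derivable1_diffP.
by case: (is_derive_smoothstep t).
Qed.

Lemma dsmoothstep_continuous : continuous dsmoothstep.
Proof.
have sh (c : R) : continuous (fun s => relu (s - c)).
  move=> t; apply: (@continuous_comp _ _ _ (fun s => s - c) relu).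
    by apply: cvgB; [exact: cvg_id|exact: cvg_cst].
  exact: relu_continuous.
move=> t; apply: cvgM; first exact: cvg_cst.
apply: cvgD; last exact: sh.
apply: cvgB; first exact: relu_continuous.
by apply: cvgM; [exact: cvg_cst|exact: sh].
Qed.

Lemma smoothstep_le0 t : t <= 0 -> smoothstep t = 0.
Proof.
rewrite /smoothstep /relu2 => t0.
case: (reluP t) (reluP (t - 2^-1)) (reluP (t - 1)) => -[? ->] [] [? ->] [] [? ->]; nra.
Qed.

Lemma smoothstep_ge1 t : 1 <= t -> smoothstep t = 1.
Proof.
rewrite /smoothstep /relu2 => t0.
case: (reluP t) (reluP (t - 2^-1)) (reluP (t - 1)) => -[? ->] [] [? ->] [] [? ->]; nra.
Qed.

Lemma dsmoothstep_ge1 t : 1 <= t -> dsmoothstep t = 0.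
Proof.
rewrite /dsmoothstep => t0.
case: (reluP t) (reluP (t - 2^-1)) (reluP (t - 1)) => -[? ->] [] [? ->] [] [? ->]; lra.
Qed.

Lemma dsmoothstep_bound t : 0 <= dsmoothstep t <= 2.
Proof.
rewrite /dsmoothstep.
case: (reluP t) (reluP (t - 2^-1)) (reluP (t - 1)) => -[? ->] [] [? ->] [] [? ->];
  by apply/andP; split; lra.
Qed.

Lemma smoothstep_homo : {homo smoothstep : s t / s <= t}.
Proof.
move=> s t st.
have [|r _] := @MVT_segment R smoothstep dsmoothstep s t st (fun x _ => is_derive_smoothstep x).
  by apply: continuous_subspaceT; exact: smoothstep_continuous.
move=> E; rewrite -subr_ge0 E mulr_ge0 ?subr_ge0 //.
by case/andP: (dsmoothstep_bound r).
Qed.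

Lemma smoothstep_bound t : 0 <= smoothstep t <= 1.
Proof.
apply/andP; split.
  have [t0|t0] := leP t 0; first by rewrite smoothstep_le0.
  by rewrite -(smoothstep_le0 (lexx 0)) smoothstep_homo // ltW.
have [t0|t0] := leP t 1; last by rewrite smoothstep_ge1 // ltW.
by rewrite -[leRHS](smoothstep_ge1 (lexx 1)) smoothstep_homo.
Qed.

End CutoffFunctions.

Section ClosedBall.
Variables (R : realType) (N : nat).
Implicit Types x : 'rV[R]_N.

Lemma compact_cball x (r : R) : compact [set y | `|x - y| <= r].
Proof.
apply: bounded_closed_compact.
  exists (`|x| + r); split; first exact: num_real.
  move=> M xM y /= xy; apply/ltW/le_lt_trans/xM.
  have -> : y = x - (x - y) by rewrite opprB addrC subrK.
  by apply: le_trans (ler_normB _ _) _; rewrite lerD2l.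
have -> : [set y | `|x - y| <= r] = (fun y => `|x - y|) @^-1` [set s | s <= r] by [].
apply: closed_comp; last exact: closed_le.
move=> y _; apply/(continuousP_dist (fun y => `|x - y|)) => e e0.
exists e => // z yz; apply: le_lt_trans (ler_dist_dist _ _) _.
by rewrite opprB addrC addrA subrK -normrN opprB.
Qed.

End ClosedBall.

(** * Riemann sums over the dyadic grid of a box *)

Section Grid.
Variables (R : realType) (N M : nat).
Notation V := 'rV[R]_N.
Implicit Types (x y : V) (O : set V) (f g : V -> R).

Definition gpt k (z : {ffun 'I_N -> 'I_(2 * M * 2 ^ k)}) : V :=
  \row_i ((z i : nat)%:R / (2 ^ k)%:R - M%:R).

Definition rsum g (k : nat) : R :=
  \sum_(z : {ffun 'I_N -> 'I_(2 * M * 2 ^ k)}) g (gpt z) / ((2 ^ k)%:R ^+ N).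

Lemma dyadic_sumE O f k :
  dyadic_sum O f M k = rsum (fun x => \1_O x * f x) k.
Proof. by []. Qed.

Lemma mesh_gt0 k : 0 < (2 ^ k)%:R :> R.
Proof. by rewrite ltr0n expn_gt0. Qed.

Lemma mesh_small (e : R) : 0 < e -> \forall k \near \oo, (2 ^ k)%:R^-1 < e.
Proof.
move=> e0; exists (Num.trunc e^-1).+1 => // k /= ek.
rewrite invf_plt ?posrE ?mesh_gt0 //.
apply: lt_le_trans (truncnS_gt _) _; rewrite ler_nat.
by rewrite (leq_trans ek) // ltnW // ltn_expl.
Qed.

Lemma ler_rsum f g k : (forall x, f x <= g x) -> rsum f k <= rsum g k.
Proof.
move=> fg; apply: ler_sum => z _; apply: ler_wpM2r => //.
Qed.

Lemma rsumD f g k : rsum (fun x => f x + g x) k = rsum f k + rsum g k.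
Proof. by rewrite /rsum -big_split; apply: eq_bigr => z _; rewrite mulrDl. Qed.

Lemma rsumZ (c : R) f k : rsum (fun x => c * f x) k = c * rsum f k.
Proof. by rewrite /rsum mulr_sumr; apply: eq_bigr => z _; rewrite mulrA. Qed.

Lemma rsumB f g k : rsum (fun x => f x - g x) k = rsum f k - rsum g k.
Proof.
by rewrite /rsum -sumrB; apply: eq_bigr => z _; rewrite mulrBl.
Qed.

Lemma rsum_sum (I : finType) (f : I -> V -> R) k :
  rsum (fun x => \sum_i f i x) k = \sum_i rsum (f i) k.
Proof.
rewrite /rsum exchange_big; apply: eq_bigr => z _; by rewrite -mulr_suml.
Qed.

Lemma rsum_norm f k : `|rsum f k| <= rsum (fun x => `|f x|) k.
Proof.
apply: le_trans (ler_norm_sum _ _ _) _; apply: ler_sum => z _.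
by rewrite normrM (@ger0_norm _ (_^-1)).
Qed.

Lemma rsum_cst (c : R) k : rsum (fun=> c) k = c * (2 * M)%:R ^+ N.
Proof.
rewrite /rsum sumr_const card_ffun !card_ord -[LHS]mulr_natl mulrCA; congr (_ * _).
rewrite natrX natrM exprMn mulfK // expf_neq0 //.
Qed.

Lemma gpt_eq k (z z' : {ffun 'I_N -> 'I_(2 * M * 2 ^ k)}) i (t : R) :
  (forall j, j != i -> z' j = z j) ->
  (z' i : nat)%:R = (z i : nat)%:R + t ->
  gpt z' = (t / (2 ^ k)%:R) *: evec R i + gpt z.
Proof.
move=> zj zi; apply/rowP => j; rewrite !mxE.
have [->|ji] := eqVneq j i; first by rewrite zi eqxx mulr1; ring.
by rewrite zj // mulr0 add0r.
Qed.

(** An open set inside the closed box misses its faces. Functions supported in [O] therefore vanish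
    at the first index of the grid and one step past the last one, which is where a cyclic shift
    wraps around. *)
Lemma in_box_strict O x i : open O -> in_box O M -> O x ->
  - M%:R < x 0 i < M%:R.
Proof.
move=> oO Obox Ox.
have : nbhs x O by exact: open_nbhs_nbhs.
move=> /near_ballP[r r0 rO].
have P (s : R) : `|s| < r -> O (s *: evec R i + x).
  move=> sr; apply: rO; rewrite opprD addrCA subrr addr0 normrN norm_evec //.
have r2 : `|r / 2| < r by rewrite gtr0_norm ?divr_gt0 // ltr_pdivrMr //; lra.
have := Obox _ i (P _ r2).
have r2' : `|- (r / 2)| < r by rewrite normrN.
have := Obox _ i (P _ r2').
rewrite /Defs.coord !mxE !eqxx /= !mulr1 => /andP[h1 h2] /andP[h3 h4].
by apply/andP; split; lra.
Qed.

(* Cyclic shift in the [i]-th index permutes the grid, and [P] vanishes where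
   the shift wraps around; hence the difference quotients of [P] sum to 0. *)
Lemma rsum_deriv_small O (i : 'I_N) (P Q : V -> R) : open O -> in_box O M ->
  compact (closure O) ->
  (forall x, is_derive x (evec R i) P (Q x)) -> continuous Q ->
  (forall x, ~ O x -> P x = 0) -> (forall x, ~ O x -> Q x = 0) ->
  forall e : R, 0 < e -> \forall k \near \oo, `|rsum Q k| <= e.
Proof.
move=> oO Obox cO dP cQ P0 Q0 e e0.
(* [(2 * M)^N] is the total weight of the grid; the added 1 keeps the divisor positive when this
   weight is 0. *)
have e1 : 0 < e / ((2 * M)%:R ^+ N + 1).
  by rewrite divr_gt0 // ltr_wpDl // exprn_ge0.
have [|d d0 Qd] := @ext_unif_cont _ _ _ Q cO cQ _ _ e1.
  by move=> x nO; apply: Q0 => Ox; apply: nO; exact: subset_closure.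
near=> k.
have hd : (2 ^ k)%:R^-1 < d by near: k; exact: mesh_small.
set h : R := (2 ^ k)%:R^-1 in hd.
have h0 : 0 < h by rewrite invr_gt0 mesh_gt0.
pose D x := (P (h *: evec R i + x) - P x) / h.
have QD x : `|Q x - D x| <= e / ((2 * M)%:R ^+ N + 1).
  have [t /andP[t0 th] E] := @line_mvt _ _ P Q x (evec R i) h (ltW h0) (fun t _ => dP _).
  rewrite /D E mulfK ?gt_eqF // ltW // Qd //.
  by rewrite opprD addrCA subrr addr0 normrN norm_evec ger0_norm // (le_lt_trans th).
have D0 : rsum D k = 0.
  rewrite /rsum /D -mulr_suml -mulr_suml sumrB.
  pose s (z : {ffun 'I_N -> 'I_(2 * M * 2 ^ k)}) :
    {ffun 'I_N -> 'I_(2 * M * 2 ^ k)} := [ffun j => if j == i then ordS (z j) else z j].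
  have sb : bijective s.
    exists (fun z : {ffun 'I_N -> 'I_(2 * M * 2 ^ k)} =>
        [ffun j => if j == i then ord_pred (z j) else z j]);
      move=> z; apply/ffunP => j; rewrite !ffunE; case: eqP => // _.
      exact: ordSK.
    exact: ord_predK.
  rewrite [X in _ - X](reindex s) /=; last exact: onW_bij.
  rewrite (eq_bigr (fun z => P (gpt (s z)))) ?subrr ?mul0r ?mul0r //.
  move=> z _.
  have [zL|zL] := ltnP (z i).+1 (2 * M * 2 ^ k).
    congr P; symmetry; rewrite -(mul1r h); apply: gpt_eq.
      by move=> j ji; rewrite ffunE (negbTE ji).
    by rewrite ffunE eqxx /= modn_small // -natr1.
  have zE : (z i).+1 = (2 * M * 2 ^ k)%N.
    by apply/eqP; rewrite eqn_leq zL ltn_ord.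
  rewrite !P0 //.
    move=> /(in_box_strict i oO Obox) /andP[+ _].
    by rewrite mxE ffunE eqxx /= zE modnn mul0r sub0r ltxx.
  move=> /(in_box_strict i oO Obox) /andP[_].
  rewrite !mxE !eqxx /= mulr1 /h -{1}(mul1r (_^-1)) addrA -mulrDl nat1r zE.
  rewrite !natrM mulfK ?gt_eqF ?mesh_gt0 //.
  by rewrite (_ : 2%:R * M%:R - M%:R = M%:R) ?ltxx //; ring.
have -> : rsum Q k = rsum (fun x => Q x - D x) k by rewrite rsumB D0 subr0.
apply: le_trans (rsum_norm _ _) _.
apply: le_trans (ler_rsum k QD) _; rewrite rsum_cst.
by rewrite mulrAC ler_pdivrMr ?ltr_wpDl ?exprn_ge0 // ler_wpM2l ?lerDl // ltW.
Unshelve. all: by end_near. Qed.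

Lemma rsum_indic (A : set V) k :
  rsum \1_A k = #|[pred z | @gpt k z \in A]|%:R / (2 ^ k)%:R ^+ N
  :> R.
Proof.
rewrite /rsum -mulr_suml -sum1_card natr_sum; congr (_ / _).
rewrite [RHS]big_mkcond /=; apply: eq_bigr => z _.
by rewrite indicE [in RHS]inE; case: (gpt z \in A).
Qed.

Lemma card_familyE (I : finType) (J : finType) (F : I -> pred J) :
  #|family F| = (\prod_i #|F i|)%N.
Proof. by rewrite card_family foldrE big_map big_enum. Qed.

Lemma eq_modn_close (a b m : nat) : (a <= b)%N -> (b < a + m)%N ->
  a = b %[mod m] -> a = b.
Proof.
move=> ab bam /eqP; rewrite eq_sym eqn_mod_dvd // => mab.
have : (b - a < m)%N by rewrite ltn_subLR.
case: (posnP (b - a)) => [/eqP|ba0 /(gtnNdvd ba0)]; last by rewrite mab.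
by rewrite subn_eq0 => ba _; apply/eqP; rewrite eqn_leq ab ba.
Qed.

(* Reducing the [j]-th index modulo [m] is injective on such a set. *)
Lemma rsum_thin (A : set V) (j : 'I_N) (m k : nat) : (0 < m)%N ->
  (forall z z' : {ffun 'I_N -> 'I_(2 * M * 2 ^ k)}, A (gpt z) -> A (gpt z') ->
     (forall i, i != j -> z i = z' i) -> (z j <= z' j)%N ->
     (z' j < z j + m)%N) ->
  rsum \1_A k <= m%:R / (2 ^ k)%:R * (2 * M)%:R ^+ N.-1 :> R.
Proof.
move=> m0 Aj; rewrite rsum_indic.
set L := (2 * M * 2 ^ k)%N.
have lt_mod (n : 'I_L) : (n %% m < L)%N.
  exact: leq_ltn_trans (leq_mod _ _) (ltn_ord _).
pose s (z : {ffun 'I_N -> 'I_L}) : {ffun 'I_N -> 'I_L} :=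
  [ffun i => if i == j then Ordinal (lt_mod (z i)) else z i].
pose F (i : 'I_N) : pred 'I_L := fun n => (i == j) ==> (n < m)%N.
have sinj : {in [pred z | @gpt k z \in A] &, injective s}.
  have main z z' : A (@gpt k z) -> A (@gpt k z') -> s z = s z' ->
      (z j <= z' j)%N -> z = z'.
    move=> Az Az' szz' zj.
    have E i : i != j -> z i = z' i.
      by move=> ij; have /ffunP/(_ i) := szz'; rewrite !ffunE (negbTE ij).
    apply/ffunP => i; have [->|] := eqVneq i j; last exact: E.
    have /ffunP/(_ j) := szz'; rewrite !ffunE eqxx => -[] /= e.
    apply: val_inj => /=; apply: (@eq_modn_close _ _ m) => //.
    exact: Aj.
  move=> z z'; rewrite !inE /= => Az Az' E.
  have [zj|/ltnW zj] := leqP (z j) (z' j); first exact: main.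
  by symmetry; apply: main.
have card_le : (#|[pred z | @gpt k z \in A]| <= m * L ^ N.-1)%N.
  rewrite -(card_in_imset sinj).
  apply: leq_trans (_ : #|family F| <= _)%N.
    apply: subset_leq_card; apply/fintype.subsetP => w /imsetP[z _ ->].
    apply/familyP => i; rewrite !ffunE /F unfold_in /=.
    by case: eqP => //= _; rewrite ltn_mod.
  rewrite card_familyE (bigD1 j) //=; apply: leq_mul.
    rewrite -sum1_card big_mkcond /=.
    rewrite (eq_bigr (fun n : 'I_L => if (n < m)%N then 1%N else 0%N)); last first.
      by move=> n _; rewrite unfold_in /F eqxx.
    rewrite -big_mkcond /= sum1_card.
    have inm (n : 'I_L) : (n %% m < m)%N by rewrite ltn_mod.
    rewrite -[X in (_ <= X)%N]card_ord.
    apply: (@leq_card_in _ _ (fun n => Ordinal (inm n))) => n n'.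
    rewrite !unfold_in /= => nm nm' [] /=.
    by rewrite !modn_small // => /val_inj.
  apply: leq_trans (_ : \prod_(i < N | i != j) L <= _)%N.
    by apply: leq_prod => i _; rewrite -[X in (_ <= X)%N]card_ord max_card.
  rewrite prod_nat_const leq_eqVlt; apply/orP; left; apply/eqP; congr (_ ^ _)%N.
  by rewrite (cardC1 j) card_ord.
rewrite ler_pdivrMr ?exprn_gt0 ?mesh_gt0 //.
apply: le_trans (_ : (m * L ^ N.-1)%:R <= _); first by rewrite ler_nat.
have -> : N = N.-1.+1 by rewrite prednK // (leq_ltn_trans _ (ltn_ord j)).
rewrite succnK exprS natrM natrX /L (natrM R (2 * M)) exprMn le_eqVlt; apply/orP; left.
apply/eqP; set c := (2 ^ k)%:R; have c0 : c != 0 :> R by rewrite gt_eqF ?mesh_gt0.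
by field.
Qed.

End Grid.

Arguments gpt {R N M k} z.

(** * Grid points in a ball, and refinement of the grid *)

Section GridBounds.
Variables (R : realType) (N M : nat).
Notation V := 'rV[R]_N.
Implicit Types (x y : V) (O : set V) (f g : V -> R).

Lemma in_box_ball O (x : V) (r : R) i (t : R) : open O -> in_box O M ->
  (forall y, `|x - y| < r -> O y) -> `|t - x 0 i| < r -> - M%:R < t < M%:R.
Proof.
move=> oO Obox rO tr.
have := in_box_strict i oO Obox (rO ((t - x 0 i) *: evec R i + x) _).
rewrite !mxE !eqxx /= mulr1 subrK; apply.
by rewrite opprD addrCA subrr addr0 normrN norm_evec.
Qed.

(** The ball is a cube of side [2 r]. The lower half of each side already holds
    [n = Num.trunc (r * 2^k)] consecutive indices, and [n] exceeds half of [r * 2^k] once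
    [r * 2^k > 2]. *)
Lemma rsum_ball O (x1 : V) (r : R) : open O -> in_box O M -> 0 < r ->
  (forall y, `|x1 - y| < r -> O y) ->
  \forall k \near \oo,
    (r / 2) ^+ N <= rsum M \1_[set y | `|x1 - y| < r] k.
Proof.
move=> oO Obox r0 rO; near=> k.
have hr : (2 ^ k)%:R^-1 < r / 2.
  by near: k; apply: mesh_small; rewrite divr_gt0.
set D : R := (2 ^ k)%:R in hr *; have D0 : 0 < D by exact: mesh_gt0.
have rD : 2 < r * D.
  have := hr; rewrite -(ltr_pM2r D0) mulVf ?gt_eqF // => h.
  have -> : r * D = 2 * (r / 2 * D) by field.
  lra.
(* This makes the argument of [Num.trunc] in [b] nonnegative; otherwise the truncation would not lie
   below it. A violation would put a point of a face of the box into the ball, hence into [O]. *)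
have xlo i : - M%:R <= x1 0 i - r.
  rewrite leNgt; apply/negP => lt1.
  have := @in_box_ball O x1 r i (- M%:R) oO Obox rO.
  have xM : - M%:R < x1 0 i.
    have Ox1 : O x1 by apply: rO; rewrite subrr normr0.
    by have /andP[] := in_box_strict i oO Obox Ox1.
  rewrite ltxx /= => h; have : false; last by [].
  by apply: h; rewrite ler0_norm; lra.
(* [b i] is the first index whose coordinate exceeds [x1 0 i - r]; adding [w < n] leads no further
   than [x1 0 i]. *)
pose b i := (Num.trunc ((x1 0 i - r + M%:R) * D)).+1.
pose n := Num.trunc (r * D).
have nle : n%:R <= r * D by rewrite truncn_le mulr_ge0 // ltW.
have ngt : r * D < n%:R + 1 by rewrite natr1 truncnS_gt.
have ble i : (b i)%:R <= (x1 0 i - r + M%:R) * D + 1.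
  rewrite /b -natr1 lerD2r truncn_le mulr_ge0 ?(ltW D0) //.
  by have := xlo i; lra.
have bgt i : (x1 0 i - r + M%:R) * D < (b i)%:R by exact: truncnS_gt.
have inball i (w : 'I_n) : `|((b i + w)%:R / D - M%:R) - x1 0 i| < r.
  have w1 : (w : nat)%:R + 1 <= n%:R :> R by rewrite natr1 ler_nat.
  have w0 : 0 <= (w : nat)%:R :> R by [].
  have -> : (b i + w)%:R / D - M%:R - x1 0 i
     = ((b i)%:R + (w : nat)%:R - (x1 0 i + M%:R) * D) / D.
    by rewrite natrD; field; rewrite gt_eqF.
  rewrite normrM (gtr0_norm (x := D^-1)) ?invr_gt0 // ltr_pdivrMr //.
  rewrite ltr_norml; have := ble i; have := bgt i; rewrite !mulrDl mulNr => h1 h2.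
  by apply/andP; split; lra.
have lt_b i (w : 'I_n) : (b i + w < 2 * M * 2 ^ k)%N.
  have /andP[_] := in_box_ball oO Obox rO (inball i w).
  rewrite ltrBlDr ltr_pdivrMr // -(ltr_nat R) !natrM => h.
  apply: lt_le_trans h _; rewrite le_eqVlt; apply/orP; left; apply/eqP.
  by rewrite /D; ring.
pose s (w : {ffun 'I_N -> 'I_n}) : {ffun 'I_N -> 'I_(2 * M * 2 ^ k)} :=
  [ffun i => Ordinal (lt_b i (w i))].
have sinj : injective s.
  move=> w w' ww'; apply/ffunP => i; have /ffunP/(_ i) := ww'.
  by rewrite !ffunE => -[] /addnI /val_inj.
rewrite rsum_indic -/D ler_pdivlMr ?exprn_gt0 // -exprMn.
apply: le_trans (_ : n%:R ^+ N <= _).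
  apply: lerXn2r; rewrite ?nnegrE //.
    by rewrite !mulr_ge0 ?invr_ge0 ?ltW.
  have -> : r / 2 * D = r * D / 2 by field.
  lra.
rewrite -natrX ler_nat -[X in (X ^ _)%N]card_ord -[X in (_ ^ X)%N](card_ord N).
rewrite -card_ffun -cardsT -(card_imset _ sinj).
apply: subset_leq_card; apply/fintype.subsetP => z /imsetP[w _ ->].
rewrite !inE /= row_norm_lt //; apply/forallP => i.
by rewrite !mxE ffunE /= distrC inball.
Unshelve. all: by end_near. Qed.

Lemma card_divn_fiber (L D : nat) (c : 'I_L) :
  #|[pred n : 'I_(L * D) | (n %/ D)%N == c]| = D.
Proof.
have lt_c (r : 'I_D) : (c * D + r < L * D)%N.
  have := ltn_ord r; have := ltn_ord c; move: (r : nat) (c : nat) => r' c' h1 h2.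
  by apply: leq_trans (_ : (c'.+1 * D <= _)%N); [lia|rewrite leq_mul2r h1 orbT].
have inj : injective (fun r : 'I_D => Ordinal (lt_c r)).
  by move=> r r' [] /addnI /val_inj.
rewrite -[RHS]card_ord -(fintype.card_image inj); apply: eq_card => n.
apply/idP/fintype.imageP => [|[r _ ->]]; rewrite inE.
  move=> /eqP nc.
  have D0 : (0 < D)%N by case: D n {lt_c inj} nc => // -[/= m]; rewrite muln0.
  have lt_r : (n %% D < D)%N by rewrite ltn_mod.
  exists (Ordinal lt_r) => //; apply: val_inj => /=.
  by rewrite -nc -divn_eq.
by rewrite /= divnMDl ?divn_small ?addn0 // (leq_ltn_trans _ (ltn_ord r)).
Qed.

(** Integer division by [2^p] sends each fine index to its coarse cell, with fibres of equal size,
    so the coarse sum is a fine sum over displaced points. The modulus [b] depends on the point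
    because [\1_O x * f x] jumps at the boundary: it is small in general and large near the
    boundary. *)
Lemma rsum_refine g b k p :
  (forall x y, `|x - y| <= (2 ^ k)%:R^-1 -> `|g x - g y| <= b x + b y) ->
  `|rsum M g (k + p) - rsum M g k| <= rsum M b (k + p) + rsum M b k.
Proof.
move=> gb.
have eL : (2 * M * 2 ^ (k + p) = 2 * M * 2 ^ k * 2 ^ p)%N.
  by rewrite expnD mulnA.
have lt_pi (n : 'I_(2 * M * 2 ^ (k + p))) : (n %/ 2 ^ p < 2 * M * 2 ^ k)%N.
  by rewrite ltn_divLR ?expn_gt0 // -eL.
pose pi (z : {ffun 'I_N -> 'I_(2 * M * 2 ^ (k + p))}) :
  {ffun 'I_N -> 'I_(2 * M * 2 ^ k)} := [ffun i => Ordinal (lt_pi (z i))].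
have fib z : #|[pred z' | pi z' == z]| = ((2 ^ p) ^ N)%N.
  pose F (i : 'I_N) : pred 'I_(2 * M * 2 ^ (k + p)) := fun n => (n %/ 2 ^ p)%N == z i.
  transitivity #|family F|.
    apply: eq_card => z'; rewrite !inE; apply/eqP/familyP => [zz' i|zz'].
      by rewrite /F unfold_in -zz' ffunE /=.
    apply/ffunP => i; apply: val_inj; rewrite ffunE /=; apply/eqP.
    by have := zz' i; rewrite /F unfold_in.
  rewrite card_familyE (eq_bigr (fun=> 2 ^ p)%N) ?prod_nat_const ?card_ord //.
  move=> i _; rewrite -[RHS](card_divn_fiber _ (z i)).
  rewrite -(fintype.card_image (@cast_ord_inj _ _ eL) (F i)); apply: eq_card => n.
  apply/fintype.imageP/idP => [[n' + ->]|]; rewrite !inE //=.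
  move=> h; exists (cast_ord (esym eL) n); first by rewrite unfold_in /= h.
  by rewrite cast_ordKV.
have coarse f : rsum M f k = \sum_z f (gpt (pi z)) / (2 ^ (k + p))%:R ^+ N.
  rewrite (partition_big pi xpredT) //=; apply: eq_bigr => z _.
  rewrite (eq_bigr (fun=> f (gpt z) / (2 ^ (k + p))%:R ^+ N)); last first.
    by move=> z' /eqP ->.
  rewrite sumr_const fib -[RHS]mulr_natl expnD natrM exprMn (natrX _ (2 ^ p)).
  have : (2 ^ k)%:R ^+ N != 0 :> R by rewrite expf_neq0 // gt_eqF // mesh_gt0.
  have : (2 ^ p)%:R ^+ N != 0 :> R by rewrite expf_neq0 // gt_eqF // mesh_gt0.
  move: ((2 ^ p)%:R ^+ N) ((2 ^ k)%:R ^+ N) => x y x0 y0.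
  by field; rewrite x0.
rewrite (coarse g) (coarse b) /rsum -sumrB -big_split /=.
apply: le_trans (ler_norm_sum _ _ _) _; apply: ler_sum => z _.
rewrite -mulrBl -mulrDl normrM (@ger0_norm _ (_^-1)) // ler_wpM2r //.
apply: gb; apply: row_norm_le => // i; rewrite !mxE ffunE /=.
rewrite opprB addrA subrK.
set D : R := (2 ^ k)%:R; set E : R := (2 ^ p)%:R.
have D0 : 0 < D by exact: mesh_gt0.
have E0 : 0 < E by exact: mesh_gt0.
have -> : (2 ^ (k + p))%:R = D * E by rewrite expnD natrM.
move: (nat_of_ord (z i)) => n; rewrite {1}(divn_eq n (2 ^ p)) natrD natrM -/E.
set c : R := (_ %/ _)%:R; set rr : R := (_ %% _)%:R.
have -> : (c * E + rr) / (D * E) - c / D = rr / E / D.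
  by field; rewrite !gt_eqF.
rewrite ger0_norm ?divr_ge0 ?(ltW D0) ?(ltW E0) // ler_pdivrMr // mulVf ?gt_eqF //.
by rewrite ler_pdivrMr // mul1r ler_nat ltnW // ltn_mod expn_gt0.
Qed.

End GridBounds.

(** * Density of the grid near a smooth boundary *)

Section Charts.
Variables (R : realType) (N M : nat) (O : set 'rV[R]_N).
Notation V := 'rV[R]_N.
Hypotheses (oO : open O) (cO : compact (closure O)).
Implicit Types (x y : V) (phi : V -> R).

Lemma smooth_on_derive (U : set V) phi x i : smooth_on U phi -> U x ->
  is_derive x (evec R i) phi (partial i phi x).
Proof. by move=> sm Ux; apply: derivableP; have [] := sm [::] x Ux. Qed.

Lemma smooth_on_continuous (U : set V) phi x : smooth_on U phi -> U x ->
  {for x, continuous phi}.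
Proof. by move=> sm Ux; have [] := sm [::] x Ux. Qed.

Lemma smooth_on_partial (U : set V) phi x i : smooth_on U phi -> U x ->
  {for x, continuous (partial i phi)}.
Proof. by move=> sm Ux; have [] := sm [:: i] x Ux. Qed.

(* On lines parallel to the axis along which the partial derivative does not
   vanish, [phi] moves at least linearly, so the grid points of such a line
   with [|phi| <= d] have few indices. *)
Lemma chart_thin x0 r phi : local_defining O x0 r phi ->
  exists r1 C : R, [/\ 0 < r1 <= r, 0 < C & forall (d : R) k, 0 < d ->
    rsum M \1_[set x | `|x0 - x| < r1 /\ `|phi x| <= d] k
      <= C * (d + (2 ^ k)%:R^-1)].
Proof.
case=> r0 [sm [[j pj] _]].
have inr x : `|x0 - x| < r -> ball x0 r x by rewrite -ball_normE.
have Bx0 : ball x0 r x0 by apply: inr; rewrite subrr normr0.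
have /continuousP_dist pc := smooth_on_partial (i := j) sm Bx0.
pose c := `|partial j phi x0| / 2.
have c0 : 0 < c by rewrite divr_gt0 // normr_gt0.
have [r2 r20 r2P] := pc c c0.
pose r1 := Num.min r r2.
have r10 : 0 < r1 by rewrite lt_min r0.
have pge x : `|x0 - x| < r1 -> c <= `|partial j phi x|.
  rewrite lt_min => /andP[_ /r2P h].
  have -> : partial j phi x = partial j phi x0 - (partial j phi x0 - partial j phi x) by ring.
  have := lerB_dist (partial j phi x0) (partial j phi x0 - partial j phi x).
  by rewrite /c in h *; lra.
have lin x (t : R) : 0 <= t -> `|x0 - x| < r1 -> `|x0 - (t *: evec R j + x)| < r1 ->
    c * t <= `|phi (t *: evec R j + x) - phi x|.
  move=> t0 bx bt.
  have seg s : 0 <= s <= t -> `|x0 - (s *: evec R j + x)| < r1.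
    move=> /andP[s0 st]; move: bx bt; rewrite !row_norm_lt //.
    move=> /forallP bx /forallP bt; apply/forallP => i.
    have := bx i; have := bt i; rewrite !mxE !ltr_norml.
    case: ((i == j)) => /=; rewrite ?andbF ?andbT ?eqxx ?mulr1 ?mulr0 ?add0r //.
    by move=> /andP[h1 h2] /andP[h3 h4]; apply/andP; split; lra.
  have [|s /seg sr ->] := @line_mvt _ _ phi (partial j phi) x (evec R j) t t0.
    move=> s /seg; rewrite lt_min => /andP[sr _].
    exact: smooth_on_derive sm (inr _ sr).
  by rewrite normrM (ger0_norm t0) ler_wpM2r // pge.
exists r1, ((2 / c + 1) * ((2 * M)%:R ^+ N.-1 + 1)); split.
- by rewrite r10 /= ge_min lexx.
- by rewrite mulr_gt0 ?ltr_wpDl // ?divr_ge0 ?exprn_ge0 // ltW.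
move=> d k d0; set h : R := (2 ^ k)%:R^-1.
have D0 : 0 < (2 ^ k)%:R :> R by exact: mesh_gt0.
have h0 : 0 < h by rewrite invr_gt0.
(* Two values of [phi] in [[-d, d]] differ by at most [2 d], so their points on the line are at most
   [2 d / c] apart, that is fewer than [m] mesh steps. *)
pose m := (Num.trunc (2 * d / c / h)).+1.
have mgt : 2 * d / c / h < m%:R by exact: truncnS_gt.
have mle : m%:R <= 2 * d / c / h + 1.
  by rewrite /m -natr1 lerD2r truncn_le !mulr_ge0 ?invr_ge0 // ltW.
apply: le_trans (_ : m%:R / (2 ^ k)%:R * (2 * M)%:R ^+ N.-1 <= _).
  apply: (@rsum_thin _ _ _ _ j) => // z z' [zr zd] [zr' zd'] zz' zj.
  have t0 : 0 <= ((z' j)%:R - (z j)%:R) * h.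
    by rewrite mulr_ge0 ?subr_ge0 ?ler_nat // ltW.
  have E : gpt z' = (((z' j)%:R - (z j)%:R) * h) *: evec R j + gpt z.
    apply: gpt_eq; first by move=> i ij; rewrite zz'.
    by rewrite addrC subrK.
  rewrite E in zr' zd'; have := lin _ _ t0 zr zr'.
  have h1 := ler_normB (phi ((((z' j)%:R - (z j)%:R) * h) *: evec R j + gpt z)) (phi (gpt z)).
  move=> /le_trans/(_ h1) h2.
  rewrite -(ltr_nat R) natrD -ltrBlDl; apply: le_lt_trans mgt.
  rewrite ler_pdivlMr // ler_pdivlMr // mulrC; lra.
rewrite -/h.
apply: le_trans (_ : (2 / c * d + h) * (2 * M)%:R ^+ N.-1 <= _).
  rewrite ler_wpM2r ?exprn_ge0 //.
  have -> : 2 / c * d + h = (2 * d / c / h + 1) * h.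
    by field; rewrite !gt_eqF.
  by rewrite ler_wpM2r // ltW.
set T := _ ^+ _; have T0 : 0 <= T by rewrite exprn_ge0.
have c2 : 0 < 2 / c by rewrite divr_gt0.
move: c2; move: (2 / c) => c' c2.
apply: le_trans (_ : (c' + 1) * (d + h) * T <= _).
  by rewrite ler_wpM2r //; nra.
have -> : (c' + 1) * (T + 1) * (d + h) = (c' + 1) * (d + h) * (T + 1) by ring.
by rewrite ler_wpM2l ?mulr_ge0 ?lerDl // ltW // addr_gt0.
Qed.

(** Distance is measured to the complement and not to the boundary, so a pair of neighbouring points
    on both sides of the boundary is a witness by itself. *)
Definition strip (d : R) : set V := [set x | O x /\ exists2 y, ~ O y & `|x - y| <= d].

Hypothesis charts : forall x0, boundary O x0 ->
  exists r phi, local_defining O x0 r phi.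

Lemma rsum_indic_mono (A B : set V) k : A `<=` B ->
  rsum M \1_A k <= rsum M \1_B k :> R.
Proof.
move=> AB; apply: ler_rsum => x; rewrite !indicE ler_nat.
by have [/set_mem/AB/mem_set ->|_] := boolP (x \in A).
Qed.

Lemma strip_mono (d d' : R) : d <= d' -> strip d `<=` strip d'.
Proof. by move=> dd' x [Ox [y nOy xy]]; split => //; exists y => //; exact: le_trans dd'. Qed.

(** Locally near an interior point the strip is empty for small [d]. Near a boundary point, [phi] is
    negative at [x] and nonnegative at a close [y] outside [O], so uniform continuity makes [phi x]
    small and [chart_thin] counts such points. Compactness of [closure O] assembles the local
    bounds. *)
Lemma strip_small (e : R) : 0 < e -> exists2 d : R, 0 < d &
  \forall k \near \oo, rsum M \1_(strip d) k <= e.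
Proof.
move=> e0.
suff: forall e : R, 0 < e -> exists2 d : R, 0 < d &
    \forall k \near \oo, rsum M \1_(closure O `&` strip d) k <= e.
  move=> /(_ e e0)[d d0 H]; exists d => //; near=> k.
  apply: le_trans (_ : rsum M \1_(closure O `&` strip d) k <= _).
    by apply: rsum_indic_mono => x [Ox ?]; split => //; exact: subset_closure.
  by near: k.
apply: (@compact_ind _ _ (fun B => forall e : R, 0 < e -> exists2 d : R, 0 < d &
    \forall k \near \oo, rsum M \1_(B `&` strip d) k <= e) cO).
- move=> B C BC PC e1 e10; have [d d0 H] := PC _ e10; exists d => //; near=> k.
  apply: le_trans (_ : rsum M \1_(C `&` strip d) k <= _).
    by apply: rsum_indic_mono => x [Bx ?]; split => //; exact: BC.
  by near: k.
- move=> e1 e10; exists 1 => //; near=> k.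
  rewrite set0I; apply: le_trans (_ : rsum M (fun=> 0) k <= _).
    by apply: ler_rsum => x; rewrite indic0.
  by rewrite rsum_cst mul0r ltW.
- move=> B C PB PC e1 e10.
  have e2 : 0 < e1 / 2 by rewrite divr_gt0.
  have [d d0 Hd] := PB _ e2; have [d' d'0 Hd'] := PC _ e2.
  exists (Num.min d d'); first by rewrite lt_min d0.
  near=> k; rewrite (splitr e1).
  apply: le_trans (_ : rsum M (fun x => \1_(B `&` strip d) x + \1_(C `&` strip d') x) k <= _).
    apply: ler_rsum => x; rewrite !indicE -natrD ler_nat.
    case: (boolP (x \in _)) => //= /set_mem [[Bx|Cx] sx].
      rewrite (_ : x \in B `&` _) ?leq_addr //; apply/mem_set; split => //.
      by apply: strip_mono sx; rewrite ge_min lexx.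
    rewrite (_ : x \in C `&` _) ?leq_addl //; apply/mem_set; split => //.
    by apply: strip_mono sx; rewrite ge_min lexx orbT.
  by rewrite rsumD; apply: lerD; near: k.
move=> z cz.
have [Oz|nOz] := pselect (O z).
  have /near_ballP[r r0 rO] : nbhs z O by exact: open_nbhs_nbhs.
  exists [set x | `|z - x| < r / 2].
    by apply/near_ballP; exists (r / 2) => //; rewrite divr_gt0.
  move=> e1 e10; exists (r / 2); rewrite ?divr_gt0 //; near=> k.
  rewrite (_ : _ `&` _ = set0).
    apply: le_trans (_ : rsum M (fun=> 0) k <= _).
      by apply: ler_rsum => x; rewrite indic0.
    by rewrite rsum_cst mul0r ltW.
  rewrite -subset0 => x [/= zx [_ [y nOy xy]]]; apply: nOy; apply: rO.
  have -> : z - y = (z - x) + (x - y) by rewrite addrA subrK.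
  apply: le_lt_trans (ler_normD _ _) _; lra.
have [r [phi ch]] : exists r phi, local_defining O z r phi by apply: charts; split.
have [r1 [C [/andP[r10 r1r] C0 thin]]] := chart_thin ch.
case: ch => _ [sm [_ defO]].
have inr x : `|z - x| < r1 -> ball z r x.
  by move=> h; rewrite -ball_normE /=; exact: lt_le_trans r1r.
exists [set x | `|z - x| < r1 / 2].
  by apply/near_ballP; exists (r1 / 2) => //; rewrite divr_gt0.
(* With [2^-k < w], the bound [C * (w + 2^-k)] from [thin] is at most [2 C w = e1]. *)
move=> e1 e10; pose w := e1 / (2 * C).
have w0 : 0 < w by rewrite divr_gt0 // mulr_gt0.
have [|d d0 dP] := @unif_cont _ _ [set y | `|z - y| <= r1 / 2] setT phi
    (@compact_cball _ _ _ _) _ w w0.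
  move=> x /= zx; have /continuousP_dist h : {for x, continuous phi}.
    by apply: smooth_on_continuous sm (inr _ _); apply: le_lt_trans zx _; lra.
  by move=> e' /h [r' r'0 H]; exists r' => // y _; exact: H.
(* [r1 / 3] keeps the outside point in the chart, as [r1 / 2 + r1 / 3 < r1]; [d / 2] yields the
   strict inequality [|x - y| < d]. *)
exists (Num.min (d / 2) (r1 / 3)); first by rewrite lt_min !divr_gt0.
near=> k.
apply: le_trans (_ : rsum M \1_[set x | `|z - x| < r1 /\ `|phi x| <= w] k <= _).
  apply: rsum_indic_mono => x [/= zx [Ox [y nOy]]].
  rewrite le_min => /andP[xyd xyr]; split; first lra.
  have zy : `|z - y| < r1.
    have -> : z - y = (z - x) + (x - y) by rewrite addrA subrK.
    apply: le_lt_trans (ler_normD _ _) _; lra.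
  have px : phi x < 0 by apply/(defO x _).1 => //; apply: inr; lra.
  have py : 0 <= phi y.
    by rewrite leNgt; apply/negP => py; apply: nOy; apply/(defO y _).2 => //; exact: inr.
  have : `|phi x - phi y| < w by apply: dP => //=; [exact: ltW|lra].
  by rewrite ltr_norml => /andP[h1 h2]; rewrite ler_norml; apply/andP; split; lra.
apply: le_trans (thin _ k w0) _.
have hk : (2 ^ k)%:R^-1 < w by near: k; exact: mesh_small.
apply: le_trans (_ : C * (w + w) <= _); first by rewrite ler_pM2l // lerD2l ltW.
by rewrite /w le_eqVlt; apply/orP; left; apply/eqP; field; rewrite gt_eqF.
Unshelve. all: by end_near. Qed.

End Charts.

(** * The divergence of compactly supported fields *)

Section CutOff.
Variables (R : realType) (N M : nat) (O : set 'rV[R]_N).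
Notation V := 'rV[R]_N.
Hypotheses (oO : open O) (Obox : in_box O M) (cO : compact (closure O)).
Implicit Types (x y : V).

Lemma near_cst_derive (f : V -> R) (x v : V) (c : R) :
  (\forall y \near x, f y = c) -> is_derive x v f 0.
Proof.
move=> fc; apply: (@near_eq_is_derive _ _ _ (cst c)).
by apply: filterS fc => y ->.
Qed.

(** Since [P] vanishes on [U] near every point outside [U], so does its derivative [Q]. The
    extensions by zero are then of class C^1 along each axis on the whole space, and
    [rsum_deriv_small] applies to each component. *)
Lemma cutoff_div (U : set V) (P Q : 'I_N -> V -> R) : open U -> U `<=` O ->
  (forall x i, U x -> is_derive x (evec R i) (P i) (Q i x)) ->
  (forall x i, U x -> {for x, continuous (Q i)}) ->
  (forall x, ~ U x -> \forall y \near x, U y -> forall i, P i y = 0) ->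
  forall e : R, 0 < e -> \forall k \near \oo,
    `|rsum M (fun x => \1_U x * \sum_i Q i x) k| <= e.
Proof.
move=> oU UO dP cQ P0 e e0.
pose ext (f : V -> R) x := \1_U x * f x.
have extU f x : U x -> ext f x = f x.
  by move=> Ux; rewrite /ext indicE mem_set // mul1r.
have extN f x : ~ U x -> ext f x = 0.
  by move=> nUx; rewrite /ext indicE memNset // mul0r.
have nU x : U x -> \forall y \near x, U y.
  by move=> Ux; apply: open_nbhs_nbhs; split.
have Q0 x : ~ U x -> \forall y \near x, U y -> forall i, Q i y = 0.
  move=> nUx; have /near_ballP[r r0 rP] := P0 x nUx.
  apply/near_ballP; exists r => // y xy Uy i.
  have [_ <-] := dP y i Uy.
  have [//] : is_derive y (evec R i) (P i) 0.
  apply: (@near_cst_derive _ _ _ 0).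
  have /near_ballP[r' r'0 r'P] := nU y Uy.
  apply/near_ballP; exists (Num.min r' (r - `|x - y|)).
    by rewrite lt_min r'0 subr_gt0.
  move=> z; rewrite lt_min => /andP[yz yz']; apply: rP; last exact: r'P.
  have -> : x - z = (x - y) + (y - z) by rewrite addrA subrK.
  by apply: le_lt_trans (ler_normD _ _) _; rewrite addrC -ltrBrDr.
have dPe x i : is_derive x (evec R i) (ext (P i)) (ext (Q i) x).
  have [Ux|nUx] := pselect (U x).
    rewrite extU //; apply: (@near_eq_is_derive _ _ _ (P i)); last exact: dP.
    by apply: filterS (nU x Ux) => y Uy; rewrite extU.
  rewrite extN //; apply: (@near_cst_derive _ _ _ 0).
  apply: filterS (P0 x nUx) => y Py; have [Uy|] := pselect (U y); last exact: extN.
  by rewrite extU // Py.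
have cQe i : continuous (ext (Q i)).
  move=> x; have [Ux|nUx] := pselect (U x).
    apply/(continuousP_dist (ext (Q i))) => e1 e10.
    have /continuousP_dist/(_ _ e10)[r r0 rP] := cQ x i Ux.
    have /near_ballP[r' r'0 r'P] := nU x Ux.
    exists (Num.min r r'); first by rewrite lt_min r0.
    move=> y; rewrite lt_min => /andP[h1 h2].
    by rewrite !extU ?rP //; exact: r'P.
  apply/(continuousP_dist (ext (Q i))) => e1 e10.
  have /near_ballP[r r0 rP] := Q0 x nUx.
  exists r => // y xy; rewrite extN //.
  have [Uy|nUy] := pselect (U y); last by rewrite extN // subrr normr0.
  by rewrite extU // rP // subrr normr0.
pose e' := e / (N%:R + 1).
have N1 : 0 < N%:R + 1 :> R by rewrite ltr_wpDl.
have e'0 : 0 < e' by rewrite divr_gt0.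
have H : \forall k \near \oo, forall i, `|rsum M (ext (Q i)) k| <= e'.
  apply: filter_forall => i.
  apply: (@rsum_deriv_small _ _ _ O i (ext (P i))) => //.
  - by move=> x nO; apply: extN => /UO.
  - by move=> x nO; apply: extN => /UO.
apply: filterS H => k H.
have -> : (fun x => \1_U x * \sum_i Q i x) = (fun x => \sum_i ext (Q i) x).
  by apply/funext => x; rewrite mulr_sumr.
rewrite rsum_sum; apply: le_trans (ler_norm_sum _ _ _) _.
apply: le_trans (ler_sum _ (fun i _ => H i)) _.
rewrite sumr_const card_ord -[_ *+ N]mulr_natr /e' -mulrA ger_pMr //.
by rewrite mulrC ler_pdivrMr // mul1r lerDl.
Qed.

End CutOff.

Lemma cvg_sum (R : realType) (T : Type) (F : set_system T) (FF : Filter F)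
  (I : Type) (r : seq I) (f : I -> T -> R) (l : I -> R) :
  (forall i, f i @ F --> l i) ->
  (fun t => \sum_(i <- r) f i t) @ F --> \sum_(i <- r) l i.
Proof.
move=> fl; elim: r => [|i r IH].
  rewrite big_nil (_ : (fun t => _) = cst 0); first exact: cvg_cst.
  by apply/funext => t; rewrite big_nil.
rewrite big_cons (_ : (fun t => _) = (fun t => f i t + \sum_(j <- r) f j t)).
  exact: cvgD.
by apply/funext => t; rewrite big_cons.
Qed.

(** * The divergence inequality for fields of small support *)

Section Divergence.
Variables (R : realType) (N M : nat) (O : set 'rV[R]_N).
Notation V := 'rV[R]_N.
Hypotheses (oO : open O) (Obox : in_box O M) (cO : compact (closure O)).
Hypothesis charts : forall x0, boundary O x0 ->
  exists r phi, local_defining O x0 r phi.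
Implicit Types (x y : V) (f : V -> R) (F G : 'I_N -> V -> R).

(** [G] has a single index because the divergence involves only the diagonal of the Jacobian. *)
Definition c1_field F G :=
  [/\ forall i, {within closure O, continuous F i},
      forall i, {within closure O, continuous G i} &
      forall x i, O x -> is_derive x (evec R i) (F i) (G i x)].

(** The gradient of a defining function is a positive multiple of the outer normal, so the sign of
    the flux can be read off without normalization. *)
Definition outward F := forall x0 r phi, boundary O x0 ->
  local_defining O x0 r phi -> 0 <= \sum_i F i x0 * partial i phi x0.

(** A nonnegative lower limit: it makes sense without convergence and is stable under finite
    sums. *)
Definition asym_ge0 (s : nat -> R) := forall e : R, 0 < e ->
  \forall k \near \oo, - e <= s k.

Definition flux_ge0 (x0 : V) (s : R) := forall F G, c1_field F G -> outward F ->
  (forall x i, O x -> s <= `|x0 - x| -> F i x = 0) ->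
  asym_ge0 (dyadic_sum O (fun x => \sum_i G i x) M).

Lemma c1_field_supp F G x0 (s : R) x i : c1_field F G ->
  (forall x i, O x -> s <= `|x0 - x| -> F i x = 0) ->
  O x -> s < `|x0 - x| -> G i x = 0.
Proof.
move=> [_ _ dF] F0 Ox sx.
have [_ <-] := dF x i Ox.
have [//] : is_derive x (evec R i) (F i) 0.
apply: (@near_cst_derive _ _ _ _ _ 0).
have /near_ballP[r r0 rO] : nbhs x O by exact: open_nbhs_nbhs.
apply/near_ballP; exists (Num.min r (`|x0 - x| - s)).
  by rewrite lt_min r0 subr_gt0.
move=> y; rewrite lt_min => /andP[h1 h2]; apply: F0; first exact: rO.
have -> : x0 - y = (x0 - x) - (y - x) by rewrite opprB addrA subrK.
apply: le_trans (lerB_dist _ _); rewrite (distrC y); lra.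
Qed.

Lemma interior_continuous f x : {within closure O, continuous f} -> O x ->
  {for x, continuous f}.
Proof.
move=> /subspace_continuousP cf Ox.
have /within_cvgP h := cf x (@subset_closure _ _ _ Ox).
apply/(continuousP_dist f) => e1 /h[r1 r10 r1P].
have /near_ballP[r2 r20 r2O] : nbhs x O by exact: open_nbhs_nbhs.
exists (Num.min r1 r2); first by rewrite lt_min r10.
move=> y; rewrite lt_min => /andP[h1 h2]; apply: r1P => //.
exact/subset_closure/r2O.
Qed.

Lemma flux_interior x0 : O x0 -> exists2 s : R, 0 < s & flux_ge0 x0 s.
Proof.
move=> Ox0; have /near_ballP[r r0 rO] : nbhs x0 O by exact: open_nbhs_nbhs.
exists (r / 2); first by rewrite divr_gt0.
move=> F G FG _ F0 e e0; have [_ cG dF] := FG.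
pose U := [set x | `|x0 - x| < r].
have oU : open U.
  rewrite (_ : U = ball x0 r); first exact: ball_open.
  by apply/seteqP; split => x; rewrite -ball_normE.
have H : \forall k \near \oo, `|rsum M (fun x => \1_U x * \sum_i G i x) k| <= e.
  apply: (@cutoff_div _ _ M O oO Obox cO U F G oU rO _ _ _ _ e0).
  - by move=> x i /rO; exact: dF.
  - by move=> x i /rO; exact: interior_continuous.
  - move=> x /negP; rewrite -leNgt => rx.
    apply/near_ballP; exists (r / 2); first by rewrite divr_gt0.
    move=> y xy Uy i; apply: F0; first exact: rO.
    have -> : x0 - y = (x0 - x) - (y - x) by rewrite opprB addrA subrK.
    apply: le_trans (lerB_dist _ _); rewrite (distrC y); lra.
apply: filterS H => k; rewrite ler_norml => /andP[He _].
rewrite dyadic_sumE.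
have -> : (fun x => \1_O x * \sum_i G i x) = (fun x => \1_U x * \sum_i G i x).
  apply/funext => x; rewrite !indicE.
  have [Ux|nUx] := pselect (U x).
    by rewrite !mem_set //; exact: rO.
  rewrite (memNset nUx) mul0r; have [Ox|nOx] := pselect (O x); last by rewrite memNset ?mul0r.
  rewrite big1 ?mulr0 // => i _; apply: (c1_field_supp (x0 := x0) (s := r / 2) _ FG) => //.
  by move/negP: nUx; rewrite -leNgt; lra.
by [].
Qed.

Lemma open_ball_norm x0 (r : R) : open [set x : V | `|x0 - x| < r].
Proof.
rewrite (_ : [set x | _] = ball x0 r); first exact: ball_open.
by apply/seteqP; split => x; rewrite -ball_normE.
Qed.

(* Inside the chart, multiplying [F] by [smoothstep (- phi / d - 1)] yields a
   compactly supported field; the error is supported in [- phi <= 2 d], a set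
   of volume [O(d)], and the gradient of the cutoff, of size [O(1 / d)], points
   against [F] up to a small quantity. *)
Lemma flux_boundary x0 : boundary O x0 -> exists2 s : R, 0 < s & flux_ge0 x0 s.
Proof.
move=> bx0; have [r [phi ch]] := charts bx0.
have [r1 [C [/andP[r10 r1r] C0 thin]]] := chart_thin M ch.
case: (ch) => r0 [sm [_ defO]].
have inr x : `|x0 - x| < r1 -> ball x0 r x.
  by move=> h; rewrite -ball_normE /=; exact: lt_le_trans r1r.
pose s := r1 / 2; have s0 : 0 < s by rewrite divr_gt0.
have sr1 : s < r1 by rewrite /s; lra.
exists s => // F G FG outF F0 e e0; have [cF cG dF] := FG.
pose Phi x := \sum_i F i x * partial i phi x.
have [CG CG0 CGP] : exists2 C : R, 0 < C & forall x, closure O x -> `|\sum_i G i x| <= C.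
  apply: (within_bounded cO); apply/subspace_continuousP => x cx.
  by apply: cvg_sum => i; have /subspace_continuousP := cG i; apply.
have PhiP (eta : R) : 0 < eta -> exists2 d : R, 0 < d & forall x, O x ->
    `|x0 - x| <= s -> - d < phi x -> - eta <= Phi x.
  move=> eta0.
  have cK : compact (closure O `&` [set x | `|x0 - x| <= s]).
    apply: compact_closedI => //; apply: compact_closed; first exact: norm_hausdorff.
    exact: compact_cball.
  suff [d d0 dP] : exists2 d : R, 0 < d & forall x,
     (closure O `&` [set x | `|x0 - x| <= s]) x -> O x -> - d < phi x -> - eta <= Phi x.
    by exists d => // x Ox xs; apply: dP => //; split => //; exact: subset_closure.
  apply: (@compact_ind _ _ (fun B => exists2 d : R, 0 < d & forall x, B x -> O x ->
    - d < phi x -> - eta <= Phi x) cK).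
  - by move=> A B AB [d d0 dP]; exists d => // x /AB; exact: dP.
  - by exists 1.
  - move=> A B [d d0 dP] [d' d'0 dP']; exists (Num.min d d').
      by rewrite lt_min d0.
    move=> x ABx Ox; rewrite ltrNl lt_min => /andP[h1 h2].
    by case: ABx => ?; [apply: dP|apply: dP'] => //; rewrite ltrNl.
  move=> z [cz /= zs].
  have zr1 : `|x0 - z| < r1 by exact: le_lt_trans sr1.
  have zball := inr _ zr1.
  have [pz|pz] := ltP (phi z) 0.
    have /continuousP_dist/(_ (- phi z / 2)) := smooth_on_continuous sm zball.
    case; first by lra.
    move=> r2 r20 r2P; exists [set x | `|z - x| < r2].
      by apply/near_ballP; exists r2.
    exists (- phi z / 2); first lra.
    by move=> x /r2P; rewrite ltr_norml => /andP[h1 h2] _ h3; exfalso; lra.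
  have bz : boundary O z by split => // /(defO z zball).1; lra.
  have zPhi : 0 <= Phi z.
    pose r2 := r - `|x0 - z|.
    have r20 : 0 < r2 by rewrite subr_gt0; exact: lt_le_trans r1r.
    have sub x : ball z r2 x -> ball x0 r x.
      rewrite -!ball_normE /= => zx.
      have -> : x0 - x = (x0 - z) + (z - x) by rewrite addrA subrK.
      by apply: le_lt_trans (ler_normD _ _) _; rewrite addrC -ltrBrDr.
    (* A chart recentred at [z] needs a nonzero gradient at [z], which the chart at [x0] does not
       provide. Where the gradient of [phi] is zero, [Phi z = 0] directly. *)
    have [[j pj]|nj] := pselect (exists j, partial j phi z != 0).
      apply: (outF z r2 phi) => //; split => //; split.
        by move=> l x /sub; exact: sm.
      by split; [exists j|move=> x /sub; exact: defO].
    rewrite /Phi big1 // => i _.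
    case: (eqVneq (partial i phi z) 0) => [->|h]; first by rewrite mulr0.
    by exfalso; apply: nj; exists i.
  have : Phi @ within (closure O) (nbhs z) --> Phi z.
    apply: cvg_sum => i; apply: cvgM.
      by have /subspace_continuousP := cF i; apply.
    by apply: cvg_within_filter; exact: smooth_on_partial sm zball.
  move=> /within_cvgP/(_ eta eta0)[r2 r20 r2P].
  exists [set x | `|z - x| < r2]; first by apply/near_ballP; exists r2.
  exists 1 => // x zx Ox _.
  have := r2P x (@subset_closure _ _ _ Ox) zx; rewrite ltr_norml => /andP[h1 h2].
  lra.
(* Error budget: [e / 4] for the cut-off field; [K * (C * (2 * d)) <= e / 4 + e / 4], from
   [d <= e / (8 * CG * C)] and this [eta]; [e / 8] for the mesh. The bound [d <= d0 / 3] puts the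
   layer [- 2 d < phi] inside [- d0 < phi], where [Phi >= - eta]. *)
pose eta := e / (16 * C).
have eta0 : 0 < eta by rewrite divr_gt0 // mulr_gt0.
have [d0 d00 d0P] := PhiP _ eta0.
pose d := Num.min (d0 / 3) (e / (8 * CG * C)).
have dgt : 0 < d by rewrite lt_min !divr_gt0 // !mulr_gt0.
(* [chi] is 0 where [phi >= - d] and 1 where [phi <= - 2 d]. *)
pose chi x := smoothstep (d^-1 * - phi x - 1).
pose dchi x := dsmoothstep (d^-1 * - phi x - 1).
pose P i x := chi x * F i x.
pose Q i x := chi x * G i x - d^-1 * dchi x * (F i x * partial i phi x).
pose U := O `&` [set x | `|x0 - x| < r1].
have oU : open U by apply: openI => //; exact: open_ball_norm.
have ballU x : U x -> ball x0 r x by case=> _ /inr.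
have chi1 x : phi x <= - (2 * d) -> chi x = 1 /\ dchi x = 0.
  move=> h; have : 1 <= d^-1 * - phi x - 1.
    rewrite lerBrDr -(ler_pM2l dgt) mulrA mulfV ?gt_eqF // mul1r; lra.
  by move=> ?; split; [exact: smoothstep_ge1|exact: dsmoothstep_ge1].
have near_small : \forall k \near \oo, `|rsum M (fun x => \1_U x * \sum_i Q i x) k| <= e / 4.
  apply: (@cutoff_div _ _ M O oO Obox cO U P Q oU) => //; last by rewrite divr_gt0.
  - by move=> x [].
  - move=> x i Ux; have dphi := smooth_on_derive i sm (ballU _ Ux).
    have dFx := dF x i Ux.1.
    have h1 : is_derive x (evec R i) (fun y => d^-1 * - phi y - 1) (d^-1 * - partial i phi x).
      have -> : (fun y => d^-1 * - phi y - 1) = d^-1 *: (- phi) - cst 1 by [].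
      by apply: is_derive_eq; rewrite subr0.
    have h2 : is_derive x (evec R i) chi (dchi x * (d^-1 * - partial i phi x)).
      exact: (is_derive_comp1 (is_derive_smoothstep _) h1).
    have -> : P i = chi * F i by [].
    by apply: is_derive_eq; rewrite /Q /GRing.scale /=; ring.
  - move=> x i Ux; have cphi := smooth_on_continuous sm (ballU _ Ux).
    have cpart := smooth_on_partial (i := i) sm (ballU _ Ux).
    have cGx := interior_continuous (cG i) Ux.1.
    have cFx := interior_continuous (cF i) Ux.1.
    have carg : {for x, continuous (fun y => d^-1 * - phi y - 1)}.
      have -> : (fun y => d^-1 * - phi y - 1)
        = (fun y => ((cst d^-1 : V -> R) \* (fun y => - phi y)) y) - cst 1 by [].
      apply: continuousB; last exact: cst_continuous.
      by apply: continuousM; [exact: cst_continuous|exact: continuousN].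
    have cchi : {for x, continuous chi}.
      apply: (@continuous_comp _ _ _ (fun y => d^-1 * - phi y - 1) (@smoothstep R)) => //.
      exact: smoothstep_continuous.
    have cdchi : {for x, continuous dchi}.
      apply: (@continuous_comp _ _ _ (fun y => d^-1 * - phi y - 1) (@dsmoothstep R)) => //.
      exact: dsmoothstep_continuous.
    have -> : Q i = (chi \* G i) - (((cst d^-1 : V -> R) \* dchi) \* (F i \* partial i phi)) by [].
    apply: continuousB; first exact: continuousM.
    by apply: continuousM; apply: continuousM => //; exact: cst_continuous.
  - move=> x nUx; have [xr|xr] := ltP `|x0 - x| r1; last first.
      apply/near_ballP; exists (r1 - s); first by rewrite subr_gt0.
      move=> y xy [Oy _] i; rewrite /P F0 ?mulr0 //.
      have -> : x0 - y = (x0 - x) - (y - x) by rewrite opprB addrA subrK.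
      apply: le_trans (lerB_dist _ _); rewrite (distrC y); lra.
    have xball := inr _ xr.
    have px : 0 <= phi x.
      by rewrite leNgt; apply/negP => /(defO x xball).2 Ox; apply: nUx.
    have /continuousP_dist/(_ d dgt)[r2 r20 r2P] := smooth_on_continuous sm xball.
    apply/near_ballP; exists r2 => // y /r2P; rewrite ltr_norml => /andP[h1 h2] _ i.
    rewrite /P /chi smoothstep_le0 ?mul0r // subr_le0 mulrC ler_pdivrMr // mul1r; lra.
pose T := [set x | `|x0 - x| < r1 /\ `|phi x| <= 2 * d].
(* [CG] pays for the factor [1 - chi] in front of the divergence; [2 * eta / d] pays for the
   gradient of [chi], since [dsmoothstep] is at most 2. *)
pose K := CG + 2 * eta / d.
have K0 : 0 < K by rewrite addr_gt0 // divr_gt0 // mulr_gt0.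
have pt x : \1_U x * \sum_i Q i x - K * \1_T x <= \1_O x * \sum_i G i x.
  have T0 : 0 <= K * \1_T x by rewrite mulr_ge0 // ltW.
  have [Ox|nOx] := pselect (O x); last first.
    rewrite !indicE (memNset nOx) (memNset (A := U)); last by case.
    by rewrite !mul0r sub0r oppr_le0 -indicE.
  have [xr|xr] := ltP `|x0 - x| r1; last first.
    rewrite !indicE (memNset (A := U)); last by case=> _ /=; rewrite ltNge xr.
    rewrite mul0r sub0r big1; last first.
      move=> i _; apply: (c1_field_supp (x0 := x0) (s := s) _ FG) => //.
      exact: lt_le_trans xr.
    by rewrite mulr0 oppr_le0 -indicE.
  have xball := inr _ xr.
  have px : phi x < 0 by exact/(defO x xball).1.
  rewrite [\1_U x]indicE [\1_O x]indicE !mem_set // !mul1r.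
  have -> : \sum_i Q i x = chi x * \sum_i G i x - d^-1 * dchi x * Phi x.
    by rewrite /Q sumrB mulr_sumr mulr_sumr.
  have := CGP x (@subset_closure _ _ _ Ox); rewrite ler_norml => /andP[g1 g2].
  have [c1 c2] := andP (smoothstep_bound (d^-1 * - phi x - 1)).
  have [c3 c4] := andP (dsmoothstep_bound (d^-1 * - phi x - 1)).
  rewrite -/(chi x) -/(dchi x) in c1 c2 c3 c4.
  have di : 0 < d^-1 by rewrite invr_gt0.
  have [p2|p2] := leP (phi x) (- (2 * d)).
    have [-> ->] := chi1 x p2; lra.
  have Tx : T x by split => //; rewrite ltr0_norm //; lra.
  rewrite indicE mem_set // mulr1.
  have flux : - (2 * eta / d) <= d^-1 * dchi x * Phi x.
    have [xs|xs] := leP `|x0 - x| s; last first.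
      have -> : Phi x = 0.
        by rewrite /Phi big1 // => i _; rewrite F0 ?mul0r // ltW.
      rewrite mulr0 oppr_le0; apply: ltW; rewrite divr_gt0 //.
      by rewrite mulr_gt0.
    have : - eta <= Phi x.
      apply: d0P => //; apply: le_lt_trans p2.
      have : d <= d0 / 3 by rewrite ge_min lexx.
      lra.
    move=> h; rewrite -[leRHS]mulrA [_ / d]mulrC -mulrN ler_pM2l //.
    move: c3 c4 h; move: (dchi x) (Phi x) => c' p' c3 c4 h.
    have : 0 <= c' * (p' + eta) by rewrite mulr_ge0 //; lra.
    have : 0 <= (2 - c') * eta by rewrite mulr_ge0 ?subr_ge0 // ltW.
    lra.
  rewrite /K; move: (\sum_i G i x) g1 g2 (Phi x) flux => g g1 g2 ph flux.
  nra.
near=> k.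
rewrite dyadic_sumE.
apply: le_trans (ler_rsum M k pt); rewrite rsumB rsumZ.
have h1 : - (e / 4) <= rsum M (fun x => \1_U x * \sum_i Q i x) k.
  have : `|rsum M (fun x => \1_U x * \sum_i Q i x) k| <= e / 4 by near: k.
  by rewrite ler_norml => /andP[].
have h2 : rsum M \1_T k <= C * (2 * d + (2 ^ k)%:R^-1).
  by apply: thin; rewrite mulr_gt0.
have hk : (2 ^ k)%:R^-1 < e / (8 * K * C).
  by near: k; apply: mesh_small; rewrite divr_gt0 // !mulr_gt0.
have h3 : K * rsum M \1_T k <= K * (C * (2 * d)) + e / 8.
  apply: le_trans (_ : K * (C * (2 * d + e / (8 * K * C))) <= _).
    rewrite ler_pM2l //; apply: le_trans h2 _; rewrite ler_pM2l // lerD2l; exact: ltW.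
  rewrite le_eqVlt; apply/orP; left; apply/eqP; field; rewrite !gt_eqF //.
have h4 : K * (C * (2 * d)) <= e / 4 + e / 4.
  have -> : K * (C * (2 * d)) = 2 * (CG * C) * d + 4 * C * eta.
    by rewrite /K; field; rewrite gt_eqF.
  apply: lerD.
    have : d <= e / (8 * CG * C) by rewrite ge_min lexx orbT.
    rewrite ler_pdivlMr ?mulr_gt0 //; lra.
  by rewrite /eta le_eqVlt; apply/orP; left; apply/eqP; field; rewrite gt_eqF.
lra.
Unshelve. all: by end_near. Qed.

End Divergence.

(** * A partition of unity on the box *)

Section PartitionOfUnity.
Variables (R : realType) (N : nat).
Notation V := 'rV[R]_N.
Implicit Types x y : V.

Lemma cvg_prod (T : Type) (F : set_system T) (FF : Filter F)
  (I : Type) (r : seq I) (f : I -> T -> R) (l : I -> R) :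
  (forall i, f i @ F --> l i) ->
  (fun t => \prod_(i <- r) f i t) @ F --> \prod_(i <- r) l i.
Proof.
move=> fl; elim: r => [|i r IH].
  rewrite big_nil (_ : (fun t => _) = cst 1); first exact: cvg_cst.
  by apply/funext => t; rewrite big_nil.
rewrite big_cons (_ : (fun t => _) = (fun t => f i t * \prod_(j <- r) f j t)).
  exact: cvgM.
by apply/funext => t; rewrite big_cons.
Qed.

Lemma dsmoothstep_le0 (t : R) : t <= 0 -> dsmoothstep t = 0.
Proof.
rewrite /dsmoothstep => t0.
case: (reluP t) (reluP (t - 2^-1)) (reluP (t - 1)) => -[? ->] [] [? ->] [] [? ->]; lra.
Qed.

(** A difference of consecutive translates of the step, so that sums over [n] telescope, both for
    the tents and for their derivatives; each tent lives in [[n - 1, n + 1]]. *)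
Definition tent (n : nat) (t : R) : R :=
  smoothstep (t - n%:R + 1) - smoothstep (t - n%:R).
Definition dtent (n : nat) (t : R) : R :=
  dsmoothstep (t - n%:R + 1) - dsmoothstep (t - n%:R).

Lemma is_derive_tent n (t : R) : is_derive t 1 (tent n) (dtent n t).
Proof.
have h (c : R) : is_derive t 1 (fun s => smoothstep (s - c)) (dsmoothstep (t - c)).
  rewrite -[X in is_derive _ _ _ X]mulr1.
  apply: (@is_derive1_comp _ (@smoothstep R) (fun s => s - c)).
    exact: is_derive_smoothstep.
  exact: is_derive_shift.
have -> : tent n = (fun s => smoothstep (s - (n%:R - 1))) - (fun s => smoothstep (s - n%:R)).
  apply/funext => s; rewrite /tent [RHS]/GRing.add /=.
  by rewrite (_ : s - (n%:R - 1) = s - n%:R + 1) //; ring.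
have h1 := h (n%:R - 1); have h2 := h n%:R.
by apply: is_derive_eq; rewrite /dtent (_ : t - (n%:R - 1) = t - n%:R + 1) //; ring.
Qed.

Lemma tent_continuous n : continuous (tent n).
Proof.
move=> t; apply: differentiable_continuous; apply/derivable1_diffP.
by case: (is_derive_tent n t).
Qed.

Lemma dtent_continuous n : continuous (dtent n).
Proof.
have h (c : R) : continuous (fun s => dsmoothstep (s - c)).
  move=> t; apply: (@continuous_comp _ _ _ (fun s => s - c) (@dsmoothstep R)).
    by apply: cvgB; [exact: cvg_id|exact: cvg_cst].
  exact: dsmoothstep_continuous.
have -> : dtent n = (fun s => dsmoothstep (s - (n%:R - 1))) - (fun s => dsmoothstep (s - n%:R)).
  apply/funext => s; rewrite /dtent [RHS]/GRing.add /=.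
  by rewrite (_ : s - (n%:R - 1) = s - n%:R + 1) //; ring.
by move=> t; apply: continuousB; exact: h.
Qed.

Lemma tent_ge0 n t : 0 <= tent n t.
Proof. by rewrite subr_ge0 smoothstep_homo // lerDl. Qed.

Lemma tent_supp n t : 1 < `|t - n%:R| -> tent n t = 0.
Proof.
rewrite ltr_normr /tent => /orP[h|h].
  by rewrite !smoothstep_ge1 ?subrr //; lra.
by rewrite !smoothstep_le0 ?subrr //; lra.
Qed.

Lemma sum_tent L t : 0 <= t -> t + 1 <= L%:R -> \sum_(n < L) tent n t = 1.
Proof.
move=> t0 tL.
have -> : \sum_(n < L) tent n t = smoothstep (t + 1) - smoothstep (t + 1 - L%:R).
  elim: L {tL} => [|L IH]; first by rewrite big_ord0 subr0 subrr.
  rewrite big_ord_recr /= IH /tent -natr1.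
  have -> : t - L%:R + 1 = t + 1 - L%:R by ring.
  have -> : t + 1 - (L%:R + 1) = t - L%:R by ring.
  by rewrite addrA subrK.
by rewrite smoothstep_ge1 ?lerDr // smoothstep_le0 ?subr0 // subr_le0.
Qed.

Lemma sum_dtent L t : 0 <= t -> t + 1 <= L%:R -> \sum_(n < L) dtent n t = 0.
Proof.
move=> t0 tL.
have -> : \sum_(n < L) dtent n t = dsmoothstep (t + 1) - dsmoothstep (t + 1 - L%:R).
  elim: L {tL} => [|L IH]; first by rewrite big_ord0 subr0 subrr.
  rewrite big_ord_recr /= IH /dtent -natr1.
  have -> : t - L%:R + 1 = t + 1 - L%:R by ring.
  have -> : t + 1 - (L%:R + 1) = t - L%:R by ring.
  by rewrite addrA subrK.
by rewrite dsmoothstep_ge1 ?lerDr // dsmoothstep_le0 ?subr0 // subr_le0.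
Qed.

Variables (M L : nat) (tau : R).
Hypotheses (tau0 : 0 < tau) (ML : 2 * M%:R / tau + 1 <= L%:R).

Definition scaled (x : V) (j : 'I_N) : R := tau^-1 * (x 0 j + M%:R).

Definition bump (z : {ffun 'I_N -> 'I_L}) (x : V) : R :=
  \prod_j tent (z j) (scaled x j).

Definition dbump (z : {ffun 'I_N -> 'I_L}) (i : 'I_N) (x : V) : R :=
  \prod_j (if j == i then tau^-1 * dtent (z j) (scaled x j)
           else tent (z j) (scaled x j)).

Lemma scaled_continuous j : continuous (scaled ^~ j).
Proof.
move=> x; apply/(continuousP_dist (scaled ^~ j)) => e e0.
exists (tau * e); first exact: mulr_gt0.
move=> y xy; have -> : scaled x j - scaled y j = tau^-1 * (x - y) 0 j.
  by rewrite /scaled !mxE; ring.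
rewrite normrM gtr0_norm ?invr_gt0 // mulrC ltr_pdivrMr // mulrC.
exact: le_lt_trans (coord_le_norm _ _) xy.
Qed.

Lemma bump_continuous z : continuous (bump z).
Proof.
move=> x; apply: (@cvg_prod _ _ (nbhs_filter x)) => j.
apply: (@continuous_comp _ _ _ (scaled ^~ j) (tent (z j))).
  exact: scaled_continuous.
exact: tent_continuous.
Qed.

Lemma dbump_continuous z i : continuous (dbump z i).
Proof.
move=> x; apply: (@cvg_prod _ _ (nbhs_filter x)) => j.
case: eqP => _.
  apply: (@continuous_comp _ _ _ (scaled ^~ j) (fun s => tau^-1 * dtent (z j) s)).
    exact: scaled_continuous.
  apply: (@continuousM _ _ (cst tau^-1) (dtent (z j))).
    exact: cst_continuous.
  exact: dtent_continuous.
apply: (@continuous_comp _ _ _ (scaled ^~ j) (tent (z j))).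
  exact: scaled_continuous.
exact: tent_continuous.
Qed.

Lemma is_derive_bump z i x : is_derive x (evec R i) (bump z) (dbump z i x).
Proof.
have E : 0 *: evec R i + x = x by rewrite scale0r add0r.
rewrite -{1}E; apply/is_derive_line.
pose C := \prod_(j | j != i) tent (z j) (scaled x j).
have -> : (fun s => bump z (s *: evec R i + x))
   = C *: (tent (z i) \o (fun s => tau^-1 *: (s + (x 0 i + M%:R)))).
  apply/funext => s; rewrite /bump (bigD1 i) //= mulrC; congr (_ * _).
    apply: eq_bigr => j ji; rewrite /scaled !mxE /= (negbTE ji) ?andbF.
    by rewrite mulr0 add0r.
  by rewrite /scaled !mxE !eqxx /= mulr1 addrA.
have h : is_derive (0 : R) 1 (fun s => tau^-1 *: (s + (x 0 i + M%:R))) tau^-1.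
  have h0 := @is_derive_shift R 0 1 (x 0 i + M%:R).
  have -> : (fun s => tau^-1 *: (s + (x 0 i + M%:R)))
    = tau^-1 *: (shift (x 0 i + M%:R) : R -> R) by [].
  by apply: is_derive_eq; rewrite [_ *: _]mulr1.
have h' := is_derive_tent (z i) (tau^-1 *: (0 + (x 0 i + M%:R))).
have hc := @is_derive1_comp _ (tent (z i)) (fun s => tau^-1 *: (s + (x 0 i + M%:R))) _ _ _ h' h.
apply: is_derive_eq; rewrite /dbump (bigD1 i) //= eqxx add0r.
rewrite [RHS]mulrC [X in _ = X * _](_ : _ = C).
  by rewrite /GRing.scale /= /scaled; ring.
by apply: eq_bigr => j /negbTE ->.
Qed.

Lemma bump_ge0 z x : 0 <= bump z x.
Proof. by apply: prodr_ge0 => j _; exact: tent_ge0. Qed.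

Definition bump_center (z : {ffun 'I_N -> 'I_L}) : V :=
  \row_j (tau * (z j : nat)%:R - M%:R).

Lemma bump_supp z x : tau < `|x - bump_center z| -> bump z x = 0.
Proof.
move=> h; have [j hj] : exists j, tau < `|(x - bump_center z) 0 j|.
  apply: contrapT => /forallNP nh; move: h; apply/negP; rewrite -leNgt.
  apply: row_norm_le; first exact: ltW.
  by move=> j; rewrite leNgt; apply/negP.
rewrite /bump (bigD1 j) //= tent_supp ?mul0r //.
rewrite -(ltr_pM2l tau0) mulr1 -[X in X * _](gtr0_norm tau0) -normrM.
rewrite (_ : tau * _ = (x - bump_center z) 0 j) //.
by rewrite /scaled !mxE; field; rewrite gt_eqF.
Qed.

Lemma scaled_bound x j : - M%:R < x 0 j < M%:R ->
  0 <= scaled x j /\ scaled x j + 1 <= L%:R.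
Proof.
move=> /andP[h1 h2]; split.
  by rewrite mulr_ge0 ?invr_ge0 ?(ltW tau0) //; lra.
apply: le_trans ML; rewrite lerD2r /scaled mulrC ler_wpM2r ?invr_ge0 ?(ltW tau0) //.
lra.
Qed.

(** By distributivity, the sum over multi-indices of products of one-variable factors is the product
    over the coordinates of sums of tents, each equal to 1. In [sum_dbump] the factor of index [i]
    is 0 instead. *)
Lemma sum_bump x : (forall j, - M%:R < x 0 j < M%:R) -> \sum_z bump z x = 1.
Proof.
move=> xM; rewrite /bump -(bigA_distr_bigA (fun j (n : 'I_L) => tent n (scaled x j))).
by rewrite big1 // => j _; have [h1 h2] := scaled_bound (xM j); exact: sum_tent.
Qed.

Lemma sum_dbump i x : (forall j, - M%:R < x 0 j < M%:R) ->
  \sum_z dbump z i x = 0.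
Proof.
move=> xM; rewrite /dbump -(bigA_distr_bigA (fun j (n : 'I_L) =>
   if j == i then tau^-1 * dtent n (scaled x j) else tent n (scaled x j))).
rewrite (bigD1 i) //= eqxx -mulr_sumr.
by have [h1 h2] := scaled_bound (xM i); rewrite sum_dtent // mulr0 mul0r.
Qed.

End PartitionOfUnity.

(** * The global divergence inequality *)

Section DivergenceTheorem.
Variables (R : realType) (N M : nat) (O : set 'rV[R]_N).
Notation V := 'rV[R]_N.
Hypotheses (oO : open O) (Obox : in_box O M) (cO : compact (closure O))
  (O0 : O !=set0).
Hypothesis charts : forall x0, boundary O x0 ->
  exists r phi, local_defining O x0 r phi.
Implicit Types (x y : V) (f : V -> R) (F G : 'I_N -> V -> R).

Lemma flux_ge0_sub x0 x (s s' : R) : `|x0 - x| + s' <= s ->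
  flux_ge0 M O x0 s -> flux_ge0 M O x s'.
Proof.
move=> xs H F G FG oF F0; apply: (H F G) => // y i Oy sy; apply: F0 => //.
have : `|x0 - y| <= `|x0 - x| + `|x - y|.
  have -> : x0 - y = (x0 - x) + (x - y) by rewrite addrA subrK.
  exact: ler_normD.
lra.
Qed.

(** A Lebesgue number argument: a field supported within [s / 2] of a point close to [z] is
    supported within [s] of [z]. *)
Lemma flux_uniform : exists2 s : R, 0 < s &
  forall x, closure O x -> flux_ge0 M O x s.
Proof.
apply: (@compact_ind _ _ (fun B => exists2 s : R, 0 < s &
  forall x, B x -> flux_ge0 M O x s) cO).
- by move=> A B AB [s s0 sP]; exists s => // x /AB; exact: sP.
- by exists 1.
- move=> A B [s s0 sP] [s' s'0 sP']; exists (Num.min s s').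
    by rewrite lt_min s0.
  move=> x [/sP|/sP']; apply: flux_ge0_sub; rewrite subrr normr0 add0r ge_min lexx ?orbT //.
move=> z cz; suff [s s0 sP] : exists2 s : R, 0 < s & flux_ge0 M O z s.
  exists [set x | `|z - x| < s / 2].
    by apply/near_ballP; exists (s / 2) => //; rewrite divr_gt0.
  exists (s / 2); first by rewrite divr_gt0.
  move=> x /= zx; apply: flux_ge0_sub sP; lra.
have [Oz|nOz] := pselect (O z); first exact: flux_interior.
exact: flux_boundary.
Qed.

Lemma asym_ge0_sum (I : finType) (s : I -> nat -> R) :
  (forall i, asym_ge0 (s i)) -> asym_ge0 (fun k => \sum_i s i k).
Proof.
move=> si e e0.
have N1 : 0 < #|I|%:R + 1 :> R by rewrite ltr_wpDl.
have e'0 : 0 < e / (#|I|%:R + 1) by rewrite divr_gt0.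
have H : \forall k \near \oo, forall i, - (e / (#|I|%:R + 1)) <= s i k.
  by apply: filter_forall => i; exact: si.
apply: filterS H => k H; apply: le_trans (ler_sum _ (fun i _ => H i)).
rewrite sumr_const -[_ *+ _]mulr_natr mulNr lerN2 mulrAC ler_pdivrMr //.
by rewrite ler_pM2l // lerDl.
Qed.

Theorem divergence_ge0 F G : c1_field O F G -> outward O F ->
  asym_ge0 (dyadic_sum O (fun x => \sum_i G i x) M).
Proof.
move=> [cF cG dF] oF; have [s s0 sP] := flux_uniform.
(* A bump lives within [tau] of its centre. A point [y] of [O] that close to the centre is within
   [2 * tau < s] of the whole support. *)
pose tau := s / 3; have tau0 : 0 < tau by rewrite divr_gt0.
pose L := (Num.trunc (2 * M%:R / tau)).+2.
have ML : 2 * M%:R / tau + 1 <= L%:R.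
  have -> : L%:R = (Num.trunc (2 * M%:R / tau)).+1%:R + 1 :> R by rewrite natr1.
  by rewrite lerD2r ltW // truncnS_gt.
pose Fz z i x := @bump R N M L tau z x * F i x.
pose Gz z i x := @bump R N M L tau z x * G i x + F i x * @dbump R N M L tau z i x.
have E : dyadic_sum O (fun x => \sum_i G i x) M
   = (fun k => \sum_z dyadic_sum O (fun x => \sum_i Gz z i x) M k).
  apply/funext => k; rewrite !dyadic_sumE.
  under [RHS]eq_bigr do rewrite dyadic_sumE.
  rewrite -rsum_sum; congr rsum; apply/funext => x.
  rewrite -mulr_sumr.
  have [Ox|nOx] := pselect (O x); last by rewrite indicE memNset // !mul0r.
  congr (_ * _); rewrite exchange_big; apply: eq_bigr => i _.
  have xM j : - M%:R < x 0 j < M%:R by exact: (@in_box_strict _ _ _ O).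
  rewrite /Gz big_split /= -mulr_suml -mulr_sumr.
  by rewrite (sum_bump tau0 ML xM) (sum_dbump tau0 ML i xM) mul1r mulr0 addr0.
rewrite E; apply: asym_ge0_sum => z.
have FGz : c1_field O (Fz z) (Gz z).
  split.
  - move=> i; apply/subspace_continuousP => x cx; apply: cvgM.
      by apply: cvg_within_filter; exact: bump_continuous.
    by have /subspace_continuousP := cF i; apply.
  - move=> i; apply/subspace_continuousP => x cx; apply: cvgD; apply: cvgM.
    + by apply: cvg_within_filter; exact: bump_continuous.
    + by have /subspace_continuousP := cG i; apply.
    + by have /subspace_continuousP := cF i; apply.
    + by apply: cvg_within_filter; exact: dbump_continuous.
  - move=> x i Ox; have h1 := dF x i Ox; have h2 := @is_derive_bump R N M L tau z i x.
    by apply: is_derive_eq; rewrite /Gz.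
have oFz : outward O (Fz z).
  move=> x0 r phi bx ch.
  rewrite (_ : \sum_i _ = bump M tau z x0 * \sum_i F i x0 * partial i phi x0).
    by rewrite mulr_ge0 ?bump_ge0 //; exact: (oF _ r).
  by rewrite mulr_sumr; apply: eq_bigr => i _; rewrite mulrA.
have [[y [Oy yz]]|ny] := pselect (exists y, O y /\ `|y - bump_center M tau z| <= tau).
  apply: (sP y (@subset_closure _ _ _ Oy) _ _ FGz oFz) => x i Ox yx.
  rewrite /Fz bump_supp ?mul0r //.
  have : `|y - x| <= `|y - bump_center M tau z| + `|x - bump_center M tau z|.
    rewrite (distrC x).
    have -> : y - x = (y - bump_center M tau z) + (bump_center M tau z - x) by rewrite addrA subrK.
    exact: ler_normD.
  rewrite /tau in yz *; lra.
(* Here no point of [O] meets the support, the localized field vanishes on [O], and any point of [O]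
   can serve as centre. *)
have [w Ow] := O0.
apply: (sP w (@subset_closure _ _ _ Ow) _ _ FGz oFz) => x i Ox _.
rewrite /Fz bump_supp ?mul0r // ltNge; apply/negP => h.
by apply: ny; exists x.
Qed.

End DivergenceTheorem.

(** * Convergence, positivity and the vanishing defect for Riemann sums *)

Section Limits.
Variables (R : realType) (N M : nat) (O : set 'rV[R]_N).
Notation V := 'rV[R]_N.
Hypotheses (oO : open O) (Obox : in_box O M) (cO : compact (closure O))
  (O0 : O !=set0).
Hypothesis charts : forall x0, boundary O x0 ->
  exists r phi, local_defining O x0 r phi.
Implicit Types (x y : V) (f : V -> R).

(** [limn] says nothing about a divergent sequence, so estimates on the sums bound [integral_over]
    only once convergence is known. *)
Lemma dyadic_sum_cvg f : {within closure O, continuous f} ->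
  cvgn (dyadic_sum O f M).
Proof.
move=> cf; apply: cauchy_cvg; apply: cauchy_exP => e e0.
have [C C0 fC] := within_bounded cO cf.
pose B : R := (2 * M)%:R ^+ N + 1.
have B0 : 0 < B by rewrite ltr_wpDl // exprn_ge0.
have e1 : 0 < e / (8 * B) by rewrite divr_gt0 // mulr_gt0.
have e2 : 0 < e / (8 * C) by rewrite divr_gt0 // mulr_gt0.
have [d d0 dP] := within_unif_cont cO cf e1.
have [d' d'0 [n _ nP]] := strip_small M oO cO charts e2.
have [n' _ n'P] : \forall k \near \oo, (2 ^ k)%:R^-1 < Num.min d d'.
  by apply: mesh_small; rewrite lt_min d0.
pose k := maxn n n'.
have hk : (2 ^ k)%:R^-1 < Num.min d d' by apply: n'P; rewrite /= leq_maxr.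
(* The first term is the modulus of continuity when both points lie in [O]. If just one does, it
   lies in the strip, and [C] bounds the jump. *)
pose b x := e / (8 * B) + C * \1_(strip O d') x.
have bP x y : `|x - y| <= (2 ^ k)%:R^-1 ->
    `|\1_O x * f x - \1_O y * f y| <= b x + b y.
  move=> /le_lt_trans/(_ hk); rewrite lt_min => /andP[xyd xyd'].
  have b0 z : e / (8 * B) <= b z by rewrite lerDl mulr_ge0 // ltW.
  have [Ox|nOx] := pselect (O x); have [Oy|nOy] := pselect (O y).
  - rewrite !indicE !mem_set // !mul1r; apply: le_trans (_ : e / (8 * B) <= _).
      by apply/ltW/dP => //; exact: subset_closure.
    by apply: le_trans (b0 x) _; rewrite lerDl (le_trans (ltW e1)).
  - rewrite !indicE (mem_set Ox) (memNset nOy) mul1r mul0r subr0.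
    apply: le_trans (fC x (@subset_closure _ _ _ Ox)) _.
    have -> : b x = e / (8 * B) + C.
      rewrite /b indicE mem_set ?mulr1 //.
      by split => //; exists y => //; exact: ltW.
    by have := b0 y; lra.
  - rewrite !indicE (mem_set Oy) (memNset nOx) mul1r mul0r sub0r normrN.
    apply: le_trans (fC y (@subset_closure _ _ _ Oy)) _.
    have -> : b y = e / (8 * B) + C.
      rewrite /b indicE mem_set ?mulr1 //.
      by split => //; exists x => //; rewrite distrC ltW.
    by have := b0 x; lra.
  - rewrite !indicE !memNset // !mul0r subrr normr0.
    by rewrite addr_ge0 // (le_trans (ltW e1)).
have bs m : (k <= m)%N -> rsum M b m <= e / 4.
  move=> km; rewrite rsumD rsum_cst rsumZ.
  have h1 : e / (8 * B) * (2 * M)%:R ^+ N <= e / 8.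
    rewrite mulrAC ler_pdivrMr ?mulr_gt0 //.
    have -> : e / 8 * (8 * B) = e * B by field.
    by rewrite ler_pM2l // lerDl.
  have h2 : C * rsum M \1_(strip O d') m <= e / 8.
    have : rsum M \1_(strip O d') m <= e / (8 * C).
      by apply: nP; rewrite /= (leq_trans _ km) // leq_maxl.
    by rewrite ler_pdivlMr ?mulr_gt0 // => h; lra.
  lra.
exists (dyadic_sum O f M k); exists k => // m /= km.
rewrite -ball_normE /= distrC !dyadic_sumE -(subnKC km).
have H := @rsum_refine R N M (fun x => \1_O x * f x) b k (m - k) bP.
apply: le_lt_trans H _; rewrite subnKC //; have := bs m km; have := bs k (leqnn k); lra.
Qed.

(** Plays the role of the positivity of the integral of a nonnegative function that is not
    identically zero, in a form uniform in the mesh. *)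
Lemma rsum_lower (T : V -> R) x1 : (forall x, O x -> 0 <= T x) -> O x1 ->
  {for x1, continuous T} -> 0 < T x1 ->
  exists2 c : R, 0 < c & \forall k \near \oo, c <= rsum M (fun x => \1_O x * T x) k.
Proof.
move=> T0 Ox1 cT Tx1.
have T2 : 0 < T x1 / 2 by rewrite divr_gt0.
have /continuousP_dist/(_ _ T2)[r r0 rP] := cT.
have /near_ballP[r' r'0 r'O] : nbhs x1 O by exact: open_nbhs_nbhs.
pose s := Num.min r r'; have s0 : 0 < s by rewrite lt_min r0.
have sO y : `|x1 - y| < s -> O y by rewrite lt_min => /andP[_ /r'O].
have := rsum_ball oO Obox s0 sO => H.
exists (T x1 / 2 * (s / 2) ^+ N).
  by rewrite mulr_gt0 // exprn_gt0 // divr_gt0.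
apply: filterS H => k H.
apply: le_trans (_ : rsum M (fun x => T x1 / 2 * \1_[set y | `|x1 - y| < s] x) k <= _).
  by rewrite rsumZ ler_pM2l.
apply: ler_rsum => x; have [xs|xs] := ltP `|x1 - x| s.
  rewrite !indicE !mem_set ?mulr1 ?mul1r //; last exact: sO.
  have : `|T x1 - T x| < T x1 / 2 by apply: rP; move: xs; rewrite lt_min => /andP[].
  by rewrite ltr_norml => /andP[h1 h2]; lra.
rewrite [X in _ * X]indicE memNset ?mulr0; last by move=> /=; rewrite ltNge xs.
have [Ox|nOx] := pselect (O x); last by rewrite indicE memNset // mul0r.
by rewrite mulr_ge0 // T0.
Qed.

(* [rho e x] stands for [u^q (u + e)^(-q)]; the positive part of [a] vanishes
   continuously where [u] does, so the product below is uniformly small away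
   from the boundary. *)
Lemma defect_small (a u : V -> R) (rho : R -> V -> R) :
  {within closure O, continuous a} -> {within closure O, continuous u} ->
  (forall x, O x -> 0 < a x -> 0 < u x) ->
  (forall e x, 0 < e -> O x -> 0 <= 1 - rho e x <= 1) ->
  (forall e x, 0 < e -> O x -> 0 < u x -> (1 - rho e x) * u x <= e) ->
  forall eta : R, 0 < eta -> exists2 e0 : R, 0 < e0 & forall e, 0 < e <= e0 ->
  \forall k \near \oo,
    rsum M (fun x => \1_O x * (relu (a x) * (1 - rho e x))) k <= eta.
Proof.
move=> ca cu au rho01 rhou eta eta0.
have [C C0 aC] := within_bounded cO ca.
have reluC x : O x -> 0 <= relu (a x) <= C.
  move=> Ox; have := aC x (@subset_closure _ _ _ Ox); rewrite ler_norml => /andP[_ h].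
  by case: (reluP (a x)) => -[h' ->]; rewrite ?lexx ?h' ?h // ltW.
pose B : R := (2 * M)%:R ^+ N + 1.
have B0 : 0 < B by rewrite ltr_wpDl // exprn_ge0.
pose e1 := eta / (2 * B).
have e10 : 0 < e1 by rewrite divr_gt0 // mulr_gt0.
have e2 : 0 < eta / (2 * C) by rewrite divr_gt0 // mulr_gt0.
have [d d0 dP] := strip_small M oO cO charts e2.
(* The points at distance at least [d] from the complement: a compact subset of [O], and the rest of
   [O] is contained in the strip. *)
pose K := closure O `&` \bigcap_(y in ~` O) [set x | d <= `|x - y|].
have KO : K `<=` O.
  move=> x [_ xK]; apply: contrapT => nOx.
  by have := xK x nOx; rewrite /= subrr normr0 leNgt d0.
have cK : compact K.
  apply: compact_closedI => //; apply: closed_bigI => y _.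
  have -> : [set x | d <= `|x - y|] = (fun x => `|x - y|) @^-1` [set s | d <= s] by [].
  apply: closed_comp; last exact: closed_ge.
  move=> x _; apply/(continuousP_dist (fun x => `|x - y|)) => e' e'0.
  exists e' => // z xz; apply: le_lt_trans (ler_dist_dist _ _) _.
  by rewrite opprB addrA subrK.
have [e0 e00 e0P] : exists2 e0 : R, 0 < e0 & forall e, 0 < e <= e0 ->
    forall x, K x -> relu (a x) * (1 - rho e x) <= e1.
  suff [e0 e00 e0P] : exists2 e0 : R, 0 < e0 & forall e, 0 < e <= e0 ->
      forall x, K x -> O x -> relu (a x) * (1 - rho e x) <= e1.
    by exists e0 => // e ee x Kx; apply: e0P => //; exact: KO.
  apply: (@compact_ind _ _ (fun B => exists2 e0 : R, 0 < e0 & forall e, 0 < e <= e0 ->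
    forall x, B x -> O x -> relu (a x) * (1 - rho e x) <= e1) cK).
  - by move=> A A' AA [s s0 sP]; exists s => // e ee x /AA; exact: sP.
  - by exists 1.
  - move=> A A' [s s0 sP] [s' s'0 sP']; exists (Num.min s s').
      by rewrite lt_min s0.
    move=> e /andP[ee]; rewrite le_min => /andP[es es'] x AAx Ox.
    by case: AAx => ?; [apply: sP|apply: sP'] => //; rewrite ee.
  move=> z /KO Oz.
  (* Either [relu (a x)] stays below [e1] near [z], or [a z > 0]; in the second case [u >= u z / 2]
     near [z] and [1 - rho e x <= e / u x] is small. *)
  have [az|az] := ltP (a z) e1.
    have az' : 0 < e1 - a z by rewrite subr_gt0.
    have /continuousP_dist/(_ _ az')[r r0 rP] := interior_continuous oO ca Oz.
    exists [set x | `|z - x| < r]; first by apply/near_ballP; exists r.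
    exists 1 => // e /andP[ee _] x /rP; rewrite ltr_norml => /andP[h1 h2] Ox.
    have ax : a x <= e1 by lra.
    have /andP[h3 h4] := rho01 e x ee Ox.
    apply: le_trans (_ : e1 * 1 <= _); last by rewrite mulr1.
    have /andP[h5 _] := reluC x Ox; apply: ler_pM => //.
    by case: (reluP (a x)) => -[_ ->] //; exact: ltW.
  have uz : 0 < u z by apply: au => //; exact: lt_le_trans az.
  have uz2 : 0 < u z / 2 by rewrite divr_gt0.
  have /continuousP_dist/(_ _ uz2)[r r0 rP] := interior_continuous oO cu Oz.
  exists [set x | `|z - x| < r]; first by apply/near_ballP; exists r.
  exists (e1 * (u z / 2) / C); first by rewrite divr_gt0 // mulr_gt0.
  move=> e /andP[ee ele] x /rP; rewrite ltr_norml => /andP[h1 h2] Ox.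
  have ux : u z / 2 <= u x by lra.
  have /andP[h3 h4] := rho01 e x ee Ox.
  have /andP[h5 h6] := reluC x Ox.
  have h7 := rhou e x ee Ox (lt_le_trans uz2 ux).
  apply: le_trans (_ : C * (1 - rho e x) <= _); first exact: ler_wpM2r.
  rewrite -(ler_pM2r uz2).
  apply: le_trans (_ : C * e <= _); last by move: ele; rewrite ler_pdivlMr // mulrC.
  rewrite -mulrA ler_pM2l //; apply: le_trans h7; exact: ler_wpM2l.
exists e0 => // e /[dup] ee /andP[egt _]; apply: filterS dP => k dP.
apply: le_trans (_ : rsum M (fun x => e1 + C * \1_(strip O d) x) k <= _).
  apply: ler_rsum => x.
  have s0 : 0 <= C * \1_(strip O d) x by rewrite mulr_ge0 // ltW.
  have [Ox|nOx] := pselect (O x); last first.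
    by rewrite indicE memNset // mul0r addr_ge0 // ltW.
  rewrite [\1_O x]indicE mem_set // mul1r.
  have [sx|nsx] := pselect (strip O d x).
    rewrite indicE mem_set // mulr1.
    have /andP[h3 h4] := rho01 e x egt Ox.
    have /andP[h5 h6] := reluC x Ox.
    apply: le_trans (_ : C * 1 <= _); first exact: ler_pM.
    by rewrite mulr1 lerDr ltW.
  apply: le_trans (_ : e1 <= _); last by rewrite lerDl.
  apply: e0P => //; split; first exact: subset_closure.
  move=> y nOy /=; rewrite leNgt; apply/negP => xy; apply: nsx; split => //.
  by exists y => //; exact: ltW.
rewrite rsumD rsum_cst rsumZ (splitr eta); apply: lerD.
  rewrite /e1 mulrAC ler_pdivrMr ?mulr_gt0 //.
  have -> : eta / 2 * (2 * B) = eta * B by field.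
  by rewrite ler_pM2l // lerDl.
move: dP; rewrite ler_pdivlMr ?mulr_gt0 // => h; lra.
Qed.

End Limits.

(** * One-variable functions and the algebra of the quadratic terms *)

Section Potential.
Variables (R : realType) (q : R).
Hypothesis q01 : 0 < q < 1.
Let q0 : 0 < q. Proof. by case/andP: q01. Qed.
Let q1 : 0 < 1 - q. Proof. by rewrite subr_gt0; case/andP: q01. Qed.

Definition pot (s : R) : R := s `^ (1 - q) / (1 - q).

Lemma is_derive_pot (s : R) : 0 < s -> is_derive s 1 pot (s `^ (- q)).
Proof.
move=> s0; have h := is_derive1_powR (1 - q) s0.
have -> : pot = (1 - q)^-1 *: ((@powR R) ^~ (1 - q)).
  by apply/funext => t; rewrite /pot mulrC.
apply: is_derive_eq; rewrite /GRing.scale /= mulrA mulVf ?gt_eqF // mul1r.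
by congr (_ `^ _); ring.
Qed.

Lemma powR_homo (r s t : R) : 0 <= r -> 0 <= s -> s <= t -> s `^ r <= t `^ r.
Proof.
move=> r0 s0 st; apply: (ge0_ler_powR r0) => //; rewrite nnegrE //.
exact: le_trans st.
Qed.

Lemma powRN_homo (s t : R) : 0 < s -> s <= t -> t `^ (- q) <= s `^ (- q).
Proof.
move=> s0 st; rewrite !powRN lef_pV2 ?posrE ?powR_gt0 ?(lt_le_trans s0) //.
by apply: powR_homo => //; exact: ltW.
Qed.

Lemma pot_homo (s t : R) : 0 <= s -> s <= t -> pot s <= pot t.
Proof.
move=> s0 st; rewrite /pot ler_wpM2r ?invr_ge0 ?(ltW q1) //.
by apply: powR_homo => //; exact: ltW.
Qed.

Lemma pot_lt (s t : R) : 0 < s -> s < t -> pot s < pot t.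
Proof.
move=> s0 st.
have dp r : s <= r <= t -> is_derive r 1 pot (r `^ (- q)).
  by move=> /andP[sr _]; apply: is_derive_pot; exact: lt_le_trans sr.
have [| |r + E] := @MVT_segment R pot (fun r => r `^ (- q)) s t (ltW st).
- by move=> r; rewrite in_itv /= => /andP[sr rt]; apply: dp; rewrite !ltW.
- apply/subspace_continuousP => r /=; rewrite in_itv /= => sr.
  apply: cvg_within_filter; apply: differentiable_continuous.
  by apply/derivable1_diffP; case: (dp r sr).
rewrite in_itv /= => /andP[sr _]; rewrite -subr_gt0 E mulr_gt0 ?subr_gt0 //.
by rewrite powR_gt0 // (lt_le_trans s0).
Qed.

(** The product is [t^q] with [t = u / (u + e)] in [(0, 1]] when [u > 0]. As [q < 1], [t <= t^q],
    and [(1 - t) * u = e * t <= e]. *)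
Lemma rho_bounds (u e : R) : 0 < e -> 0 <= u ->
  0 <= 1 - u `^ q * (u + e) `^ (- q) <= 1 /\
  (0 < u -> (1 - u `^ q * (u + e) `^ (- q)) * u <= e).
Proof.
move=> e0 u0; have ue : 0 < u + e by rewrite ltr_wpDl.
have pos : 0 <= u `^ q * (u + e) `^ (- q) by rewrite mulr_ge0 ?powR_ge0.
have le1 : u `^ q * (u + e) `^ (- q) <= 1.
  rewrite powRN ler_pdivrMr ?powR_gt0 // mul1r.
  by apply: powR_homo; rewrite ?(ltW q0) // lerDl ltW.
split; first by apply/andP; split; lra.
move=> ugt; set t := u / (u + e).
have t0 : 0 < t by rewrite divr_gt0.
have t1 : t <= 1 by rewrite ler_pdivrMr // mul1r lerDl ltW.
have -> : u `^ q * (u + e) `^ (- q) = t `^ q.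
  rewrite /t powRM ?invr_ge0 ?(ltW ue) // powRN; congr (_ * _).
  by rewrite -[in RHS](powR_inv1 (ltW ue)) -powRrM mulN1r powRN.
have tq : t <= t `^ q.
  by apply: ger1_powR; [rewrite t0|case/andP: q01 => _ /ltW].
apply: le_trans (_ : (1 - t) * u <= _).
  by rewrite ler_wpM2r // lerD2l lerN2.
have -> : (1 - t) * u = e * t by rewrite /t; field; rewrite gt_eqF.
by rewrite ger_pMr.
Qed.

(* Cauchy-Schwarz in the form (x + y)^2 / (b + c) <= x^2 / b + y^2 / c; the gap
   [m] between [A] and [B] leaves room for the negative term. *)
Lemma quotient_gap (P Q A B m : R) : 0 < m -> 0 < B -> B + m <= A ->
  P ^+ 2 / A - Q ^+ 2 / B
    <= 4 / m * (P - Q) ^+ 2 - m / (4 * A ^+ 2) * P ^+ 2.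
Proof.
move=> m0 B0 AB.
have A0 : 0 < A by lra.
(* The gap is split: [b >= B] allows replacing [B] by [b], [c] is the weight of [(P - Q)^2], and
   [b + c = A - m / 4] leaves a quarter of the gap for the negative term. *)
pose b := A - m / 2; have b0 : 0 < b by rewrite /b; lra.
pose c := m / 4; have c0 : 0 < c by rewrite divr_gt0.
have bc : b + c = A - m / 4 by rewrite /b /c; field.
have bc0 : 0 < b + c by rewrite addr_gt0.
have h1 : Q ^+ 2 / b <= Q ^+ 2 / B.
  by rewrite ler_wpM2l ?sqr_ge0 // lef_pV2 ?posrE // /b; lra.
have h2 : P ^+ 2 / (b + c) <= Q ^+ 2 / b + (P - Q) ^+ 2 / c.
  have -> : Q ^+ 2 / b + (P - Q) ^+ 2 / c
    = P ^+ 2 / (b + c) + (c * Q - b * (P - Q)) ^+ 2 / (b * c * (b + c)).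
    by field; rewrite !gt_eqF.
  by rewrite lerDl divr_ge0 ?sqr_ge0 // !mulr_ge0 // ltW.
(* Since [b + c = A - c], this is [(A + c) * (A - c) <= A^2]. *)
have h3 : P ^+ 2 / A + m / (4 * A ^+ 2) * P ^+ 2 <= P ^+ 2 / (b + c).
  have -> : P ^+ 2 / A + m / (4 * A ^+ 2) * P ^+ 2 = P ^+ 2 * ((A + c) / A ^+ 2).
    by rewrite /c; field; rewrite gt_eqF.
  rewrite ler_wpM2l ?sqr_ge0 // ler_pdivrMr ?exprn_gt0 // [leRHS]mulrC.
  by rewrite ler_pdivlMr // bc -/c expr2; nra.
have -> : 4 / m * (P - Q) ^+ 2 = (P - Q) ^+ 2 / c by rewrite /c; field; rewrite gt_eqF.
lra.
Qed.

Variables (lam m0 : R).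
Hypothesis lam0 : 0 < lam.

(** The squared positive part makes [psi] of class C^1 and zero up to [m0]. The exponential gives
    [dpsi >= lam * psi], so that a large [lam] absorbs any multiple of [(P - Q)^2]. *)
Definition psi (s : R) : R := relu2 (s - m0) * expR (lam * s).
Definition dpsi (s : R) : R :=
  2 * relu (s - m0) * expR (lam * s) + lam * psi s.

Lemma is_derive_psi (s : R) : is_derive s 1 psi (dpsi s).
Proof.
have h1 : is_derive s 1 (fun t => relu2 (t - m0)) (2 * relu (s - m0)).
  rewrite -[X in is_derive _ _ _ X]mulr1.
  apply: (@is_derive1_comp _ (@relu2 R) (fun t => t - m0)).
    exact: is_derive_relu2.
  exact: is_derive_shift.
have h2 : is_derive s 1 (fun t => expR (lam * t)) (expR (lam * s) * lam).
  apply: (@is_derive1_comp _ (@expR R) (fun t => lam * t)).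
  have -> : (fun t => lam * t) = lam *: (@id R) by [].
  by apply: is_derive_eq; rewrite [_ *: _]mulr1.
have -> : psi = (fun t => relu2 (t - m0)) * (fun t => expR (lam * t)) by [].
apply: is_derive_eq; rewrite /dpsi /psi /GRing.scale /=; ring.
Qed.

Lemma psi_ge0 s : 0 <= psi s.
Proof. by rewrite mulr_ge0 ?relu2_ge0 // expR_ge0. Qed.

Lemma psi_gt0 s : m0 < s -> 0 < psi s.
Proof.
move=> ms; rewrite mulr_gt0 ?expR_gt0 // /relu2 exprn_gt0 //.
by case: (reluP (s - m0)) => -[h ->]; lra.
Qed.

Lemma psi_le0 s : s <= m0 -> psi s = 0 /\ dpsi s = 0.
Proof.
move=> ms; have r0 : relu (s - m0) = 0 by case: (reluP (s - m0)) => -[h ->]; lra.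
have p0 : psi s = 0 by rewrite /psi /relu2 r0 expr0n mul0r.
by rewrite /dpsi p0 r0 !mulr0 mul0r addr0.
Qed.

Lemma dpsi_ge s : lam * psi s <= dpsi s.
Proof.
rewrite lerDr mulr_ge0 ?expR_ge0 // mulr_ge0 //.
by case: (reluP (s - m0)) => -[h ->].
Qed.

Lemma psi_homo : {homo psi : s t / s <= t}.
Proof.
move=> s t st; rewrite /psi; apply: ler_pM; rewrite ?relu2_ge0 ?expR_ge0 //.
  rewrite /relu2; case: (reluP (s - m0)) (reluP (t - m0)) => -[h ->] [] [h' ->]; nra.
by rewrite ler_expR ler_pM2l.
Qed.

Lemma dpsi_continuous : continuous dpsi.
Proof.
have cexp : continuous (fun t => expR (lam * t)).
  move=> t; apply: (@continuous_comp _ _ _ (fun t => lam * t) (@expR R)).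
    by apply: (@continuousM _ _ (cst lam) id); [exact: cst_continuous|exact: cvg_id].
  exact: continuous_expR.
have cpsi : continuous psi.
  move=> t; apply: differentiable_continuous; apply/derivable1_diffP.
  by case: (is_derive_psi t).
have crelu : continuous (fun t => relu (t - m0)).
  move=> t; apply: (@continuous_comp _ _ _ (fun t => t - m0) (@relu R)).
    by apply: cvgB; [exact: cvg_id|exact: cvg_cst].
  exact: relu_continuous.
move=> t; apply: cvgD; last by apply: cvgM; [exact: cvg_cst|exact: cpsi].
by apply: cvgM; [apply: cvgM; [exact: cvg_cst|exact: crelu]|exact: cexp].
Qed.

End Potential.

(** * Fields built from a classical solution *)

Section ClassicalData.
Variables (R : realType) (N : nat) (O : set 'rV[R]_N).
Notation V := 'rV[R]_N.
Hypotheses (oO : open O) (cO : compact (closure O)).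
Implicit Types (x y : V) (u : V -> R) (Du Lu : 'I_N -> V -> R).

(** [Lu i] is the pure second derivative in direction [i]; the Laplacian and the divergence of [flx]
    involve no mixed ones. *)
Definition c2_data u Du Lu :=
  [/\ {within closure O, continuous u},
      forall i, {within closure O, continuous Du i},
      forall i, {within closure O, continuous Lu i} &
      forall x i, O x -> is_derive x (evec R i) u (Du i x) /\
                         is_derive x (evec R i) (Du i) (Lu i x)].

Lemma within_comp (g : R -> R) (f : V -> R) :
  {within closure O, continuous f} ->
  (forall x, closure O x -> {for f x, continuous g}) ->
  {within closure O, continuous (g \o f)}.
Proof.
move=> /subspace_continuousP cf cg; apply/subspace_continuousP => x cx.
exact: (cvg_comp _ _ (cf x cx) (cg x cx)).
Qed.

Lemma within_mul (f g : V -> R) : {within closure O, continuous f} ->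
  {within closure O, continuous g} ->
  {within closure O, continuous (fun x => f x * g x)}.
Proof.
move=> /subspace_continuousP cf /subspace_continuousP cg.
by apply/subspace_continuousP => x cx; apply: cvgM; [exact: cf|exact: cg].
Qed.

Lemma within_add (f g : V -> R) : {within closure O, continuous f} ->
  {within closure O, continuous g} ->
  {within closure O, continuous (fun x => f x + g x)}.
Proof.
move=> /subspace_continuousP cf /subspace_continuousP cg.
by apply/subspace_continuousP => x cx; apply: cvgD; [exact: cf|exact: cg].
Qed.

Lemma within_opp (f : V -> R) : {within closure O, continuous f} ->
  {within closure O, continuous (fun x => - f x)}.
Proof.
move=> /subspace_continuousP cf.
by apply/subspace_continuousP => x cx; apply: cvgN; exact: cf.
Qed.

Lemma within_cst (c : R) : {within closure O, continuous (fun _ : V => c)}.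
Proof. by apply/subspace_continuousP => x cx; exact: cvg_cst. Qed.

Lemma derivable_continuous (g : R -> R) (s dg : R) :
  is_derive s 1 g dg -> {for s, continuous g}.
Proof.
by move=> [h _]; apply: differentiable_continuous; apply/derivable1_diffP.
Qed.

Lemma closure_ge0 (f : V -> R) : {within closure O, continuous f} ->
  (forall x, O x -> 0 <= f x) -> forall x, closure O x -> 0 <= f x.
Proof.
move=> /subspace_continuousP cf f0 x cx.
have {}cf : f @ within (closure O) (nbhs x) --> f x by exact: cf.
rewrite leNgt; apply/negP => fx.
have fx' : 0 < - f x by rewrite oppr_gt0.
have /within_cvgP/(_ _ fx')[r r0 rP] := cf.
have [y [Oy xy]] : O `&` [set y | `|x - y| < r] !=set0.
  by apply: cx; apply/near_ballP; exists r.
have := rP y (@subset_closure _ _ _ Oy) xy; have := f0 y Oy.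
by rewrite ltr_norml => h /andP[h1 h2]; lra.
Qed.

Lemma solution_data (a u : V -> R) (q alpha : R) : solution O a q alpha u ->
  exists Du Lu, [/\ c2_data u Du Lu,
    forall x, closure O x -> 0 <= u x,
    forall x, O x -> \sum_i Lu i x = - (a x * u x `^ q) &
    forall x0 r phi, boundary O x0 -> local_defining O x0 r phi ->
      \sum_i Du i x0 * partial i phi x0
        = alpha * u x0 * Num.sqrt (\sum_i (partial i phi x0) ^+ 2)].
Proof.
case=> r [Du [D2u [_ [cu [cDu [cD2u [du [u0 [eqn bd]]]]]]]]].
exists Du, (fun i => D2u i i); split => //.
- split => //; first by move=> i; case: (cD2u i i).
  move=> x i Ox; have [d1 [e1 d2]] := du x Ox i.
  have [d3 e3] := d2 i.
  split; first by rewrite -e1; exact: derivableP.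
  by rewrite -e3; exact: derivableP.
- exact: closure_ge0.
- by move=> x Ox; rewrite -(eqn x Ox) opprK.
Qed.

Lemma second_derive_zero u Du Lu (U : set V) x i : c2_data u Du Lu ->
  open U -> U `<=` O -> (forall y, U y -> Du i y = 0) -> U x -> Lu i x = 0.
Proof.
move=> [_ _ _ d] oU UO D0 Ux; have [_ [_ <-]] := d x i (UO _ Ux).
have [//] : is_derive x (evec R i) (Du i) 0.
apply: (@near_cst_derive _ _ _ _ _ 0).
have nU : nbhs x U by exact: open_nbhs_nbhs.
exact: filterS nU.
Qed.

Variable q : R.
Hypothesis q01 : 0 < q < 1.

(** This is the gradient of [pot q \o u], so one expression serves as a field to integrate and as
    the gradient of the functions being compared. *)
Definition flx u Du (i : 'I_N) x : R := u x `^ (- q) * Du i x.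
Definition dflx u Du Lu (i : 'I_N) x : R :=
  u x `^ (- q) * Lu i x - q * u x `^ (- q - 1) * Du i x ^+ 2.

Lemma powR_continuous (r s : R) : 0 < s -> {for s, continuous (@powR R ^~ r)}.
Proof. by move=> s0; exact: derivable_continuous (is_derive1_powR r s0). Qed.

Lemma flx_c1 u Du Lu : c2_data u Du Lu -> (forall x, closure O x -> 0 < u x) ->
  c1_field O (flx u Du) (dflx u Du Lu).
Proof.
move=> [cu cDu cLu d] u0.
have cp r : {within closure O, continuous (fun x => u x `^ r)}.
  by apply: (within_comp (g := @powR R ^~ r) cu) => x cx; apply: powR_continuous; exact: u0.
split.
- by move=> i; apply: within_mul.
- move=> i; apply: within_add; first exact: within_mul.
  apply: within_opp; apply: within_mul; first by apply: within_mul => //; exact: within_cst.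
  exact: within_mul.
- move=> x i Ox; have [d1 d2] := d x i Ox.
  have ux : 0 < u x by apply: u0; exact: subset_closure.
  have d3 := is_derive_comp1 (is_derive1_powR (- q) ux) d1.
  have -> : flx u Du i = ((@powR R ^~ (- q)) \o u) * Du i by [].
  by apply: is_derive_eq; rewrite /dflx /GRing.scale /=; ring.
Qed.

Lemma pot_data u Du Lu : c2_data u Du Lu -> (forall x, closure O x -> 0 < u x) ->
  {within closure O, continuous (pot q \o u)} /\
  forall x i, O x -> is_derive x (evec R i) (pot q \o u) (flx u Du i x).
Proof.
move=> [cu _ _ d] u0; split.
  apply: within_comp => // x cx.
  by apply: derivable_continuous (is_derive_pot q01 _); exact: u0.
move=> x i Ox; have [d1 _] := d x i Ox.
apply: (is_derive_comp1 (is_derive_pot q01 _) d1).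
by apply: u0; exact: subset_closure.
Qed.

Lemma c2_data_shift u Du Lu (e : R) : c2_data u Du Lu ->
  c2_data (fun x => u x + e) Du Lu.
Proof.
move=> [cu cDu cLu d]; split => //.
  by apply: within_add => //; exact: within_cst.
move=> x i Ox; have [d1 d2] := d x i Ox; split => //.
have -> : (fun x => u x + e) = u + cst e by [].
by apply: is_derive_eq; rewrite addr0.
Qed.

Lemma sum_dflx u Du Lu x : \sum_i dflx u Du Lu i x
  = u x `^ (- q) * (\sum_i Lu i x)
    - q * u x `^ (- q - 1) * \sum_i Du i x ^+ 2.
Proof. by rewrite /dflx sumrB !mulr_sumr. Qed.

End ClassicalData.

(** * Negativity of the integral of [a] *)

Section Part1.
Variables (R : realType) (N M : nat) (O : set 'rV[R]_N).
Notation V := 'rV[R]_N.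
Hypotheses (oO : open O) (Obox : in_box O M) (cO : compact (closure O))
  (O0 : O !=set0).
Hypothesis charts : forall x0, boundary O x0 ->
  exists r phi, local_defining O x0 r phi.
Variables (a u : V -> R) (q alpha : R).
Hypotheses (q01 : 0 < q < 1) (alpha0 : 0 <= alpha).
Hypotheses (ca : {within closure O, continuous a})
  (apos : exists x, O x /\ 0 < a x)
  (au : forall x, O x -> 0 < a x -> 0 < u x).
Hypothesis sol : solution O a q alpha u.

Lemma robin_outward Du (c : V -> R) : (forall x, boundary O x -> 0 <= c x) ->
  (forall x, closure O x -> 0 <= u x) ->
  (forall x0 r phi, boundary O x0 -> local_defining O x0 r phi ->
      \sum_i Du i x0 * partial i phi x0
        = alpha * u x0 * Num.sqrt (\sum_i (partial i phi x0) ^+ 2)) ->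
  outward O (fun i x => c x * Du i x).
Proof.
move=> c0 u0 bd x0 r phi bx ch.
have -> : \sum_i c x0 * Du i x0 * partial i phi x0
   = c x0 * \sum_i Du i x0 * partial i phi x0.
  by rewrite mulr_sumr; apply: eq_bigr => i _; rewrite mulrA.
rewrite (bd x0 r phi) // mulr_ge0 ?c0 // mulr_ge0 ?sqrtr_ge0 // mulr_ge0 //.
by apply: u0; case: bx.
Qed.

Lemma rho_defect eta : 0 < eta -> exists2 e0 : R, 0 < e0 & forall e, 0 < e <= e0 ->
  \forall k \near \oo,
    rsum M (fun x => \1_O x * (relu (a x) * (1 - u x `^ q * (u x + e) `^ (- q)))) k <= eta.
Proof.
have [Du [Lu [[cu _ _ _] u0 _ _]]] := solution_data sol.
apply: (@defect_small _ _ M O oO cO charts a u (fun e x => u x `^ q * (u x + e) `^ (- q))) => //.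
  by move=> e x e0 Ox; have [] := rho_bounds q01 e0 (u0 x (@subset_closure _ _ _ Ox)).
by move=> e x e0 Ox ux; have [_] := rho_bounds q01 e0 (u0 x (@subset_closure _ _ _ Ox)); apply.
Qed.

Lemma integral_over_lt0 : integral_over O a M < 0.
Proof.
have [Du [Lu [Hu u0 eqn bd]]] := solution_data sol.
have [cu cDu cLu du] := Hu.
(* With [u + 1] in place of [u + e], [T] is independent of [e] and lies below the true quadratic
   term for all [e <= 1]. Its lower bound [c] can thus be fixed before [e]. *)
pose T x := q * (u x + 1) `^ (- q - 1) * \sum_i Du i x ^+ 2.
have q0 : 0 < q by case/andP: q01.
have S0 x : 0 <= \sum_i Du i x ^+ 2 by apply: sumr_ge0 => i _; exact: sqr_ge0.
have T0 x : O x -> 0 <= T x.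
  by move=> _; rewrite /T mulr_ge0 // mulr_ge0 ?powR_ge0 // ltW.
have [x1 Ox1 Tx1] : exists2 x1, O x1 & 0 < T x1.
  (* If [T] vanished on [O], so would the gradient and the Laplacian of [u], hence [a * u^q],
     contrary to [u > 0] at a point where [a > 0]. *)
  apply: contrapT => nT.
  have D0 x i : O x -> Du i x = 0.
    move=> Ox; have ux : 0 < u x + 1 by rewrite ltr_wpDl ?u0 //; exact: subset_closure.
    have : \sum_i Du i x ^+ 2 = 0.
      apply: contrapT => /eqP h; apply: nT; exists x => //.
      by rewrite /T mulr_gt0 ?mulr_gt0 ?powR_gt0 // lt_def h S0.
    move=> /eqP; rewrite psumr_eq0; last by move=> j _; exact: sqr_ge0.
    by move=> /allP/(_ i); rewrite mem_index_enum sqrf_eq0 => /(_ isT)/eqP.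
  have [x [Ox ax]] := apos.
  have := eqn x Ox; rewrite big1 => [/esym/eqP|i _]; last first.
    by apply: (second_derive_zero Hu oO) => // y; exact: D0.
  by rewrite oppr_eq0 mulf_eq0 !gt_eqF // powR_gt0 // au.
have cT : {for x1, continuous T}.
  apply: (interior_continuous oO _ Ox1); apply: within_mul.
    apply: within_mul; first exact: within_cst.
    apply: (within_comp (f := fun x => u x + 1) (g := @powR R ^~ (- q - 1))).
      by apply: within_add => //; exact: within_cst.
    by move=> x cx; apply: powR_continuous; rewrite ltr_wpDl // u0.
  apply/subspace_continuousP => x cx; apply: cvg_sum => i; apply: cvgM;
    by have /subspace_continuousP := cDu i; apply.
have [c c0 cP] := rsum_lower oO Obox T0 Ox1 cT Tx1.
have c4 : 0 < c / 4 by rewrite divr_gt0.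
have [e0 e00 e0P] := rho_defect c4.
pose e := Num.min e0 1.
have egt : 0 < e by rewrite lt_min e00 ltr01.
have e1 : e <= 1 by rewrite ge_min lexx orbT.
have dP : \forall k \near \oo,
    rsum M (fun x => \1_O x * (relu (a x) * (1 - u x `^ q * (u x + e) `^ (- q)))) k <= c / 4.
  by apply: e0P; rewrite egt ge_min lexx.
have ue x : closure O x -> 0 < u x + e by move=> cx; rewrite ltr_wpDl // u0.
pose G := dflx q (fun x => u x + e) Du Lu.
have divP : asym_ge0 (dyadic_sum O (fun x => \sum_i G i x) M).
  apply: (@divergence_ge0 _ _ M O oO Obox cO O0 charts (flx q (fun x => u x + e) Du)).
    by apply: flx_c1; [exact: c2_data_shift|exact: ue].
  apply: (robin_outward (c := fun x => (u x + e) `^ (- q))) => //.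
  by move=> x _; exact: powR_ge0.
have {}divP := divP _ c4.
have pt x : \1_O x * a x <= \1_O x * (relu (a x) * (1 - u x `^ q * (u x + e) `^ (- q)))
     - \1_O x * \sum_i G i x - \1_O x * T x.
  have [Ox|nOx] := pselect (O x); last by rewrite indicE memNset // !mul0r !subr0.
  rewrite indicE mem_set // !mul1r /G sum_dflx eqn //.
  have cx := @subset_closure _ _ _ Ox.
  have [/andP[r1 r2] _] := rho_bounds q01 egt (u0 x cx).
  move: r1 r2; set rho := u x `^ q * _ => r1 r2.
  have -> : (u x + e) `^ (- q) * - (a x * u x `^ q) = - (a x * rho).
    by rewrite /rho; ring.
  have TT : T x <= q * (u x + e) `^ (- q - 1) * \sum_i Du i x ^+ 2.
    rewrite /T ler_wpM2r // ler_wpM2l ?(ltW q0) //.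
    rewrite -opprD !powRN lef_pV2 ?posrE ?powR_gt0 ?ue //; last first.
      by rewrite ltr_wpDl // u0.
    by apply: powR_homo; rewrite ?addr_ge0 ?(ltW q0) ?(ltW egt) ?u0 // lerD2l.
  have : a x * (1 - rho) <= relu (a x) * (1 - rho).
    by rewrite ler_wpM2r //; case: (reluP (a x)) => -[h ->].
  lra.
(* The defect and the divergence cost [c / 4] each, against a gain of [c]. *)
rewrite /integral_over; apply: (@le_lt_trans _ _ (- (c / 2))); last lra.
apply: limr_le; first exact: dyadic_sum_cvg.
near=> k.
have h1 : c <= rsum M (fun x => \1_O x * T x) k by near: k.
have h2 : rsum M (fun x => \1_O x * (relu (a x) * (1 - u x `^ q * (u x + e) `^ (- q)))) k <= c / 4.
  by near: k.
have h3 : - (c / 4) <= dyadic_sum O (fun x => \sum_i G i x) M k by near: k.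
rewrite dyadic_sumE; apply: le_trans (ler_rsum M k pt) _.
rewrite rsumB rsumB; rewrite dyadic_sumE in h3; lra.
Unshelve. all: by end_near. Qed.

End Part1.

(** * Functions with zero gradient on a ball *)

Section LocallyConstant.
Variables (R : realType) (N : nat).
Notation V := 'rV[R]_N.
Implicit Types (x y : V) (f : V -> R).

Lemma line_const f x i (t r : R) (x0 : V) :
  (forall y j, `|x0 - y| < r -> is_derive y (evec R j) f 0) ->
  `|x0 - x| < r -> `|x0 - (t *: evec R i + x)| < r ->
  f (t *: evec R i + x) = f x.
Proof.
wlog t0 : x t / 0 <= t.
  move=> H df xr tr; have [|/ltW t0] := leP 0 t; first by move=> ?; exact: H.
  have E : - t *: evec R i + (t *: evec R i + x) = x.
    by rewrite addrA -scalerDl addNr scale0r add0r.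
  by rewrite -[in RHS]E; symmetry; apply: H => //; rewrite ?oppr_ge0 ?E.
move=> df xr tr; have r0 : 0 < r by exact: le_lt_trans xr.
have seg s : 0 <= s <= t -> `|x0 - (s *: evec R i + x)| < r.
  move=> /andP[s0 st]; move: xr tr; rewrite !row_norm_lt //.
  move=> /forallP bx /forallP bt; apply/forallP => j.
  have := bx j; have := bt j; rewrite !mxE !ltr_norml.
  case: ((j == i)) => /=; rewrite ?andbF ?andbT ?eqxx ?mulr1 ?mulr0 ?add0r //.
  by move=> /andP[h1 h2] /andP[h3 h4]; apply/andP; split; lra.
have [|s _] := @line_mvt _ _ f (fun=> 0) x (evec R i) t t0.
  by move=> s /seg; exact: df.
by rewrite mul0r => /eqP; rewrite subr_eq0 => /eqP.
Qed.

(** The coordinates of [x0] are replaced by those of [y] one at a time; the intermediate points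
    [w n] stay in the ball because it is a cube. *)
Lemma ball_const f x0 (r : R) :
  (forall y j, `|x0 - y| < r -> is_derive y (evec R j) f 0) ->
  forall y, `|x0 - y| < r -> f y = f x0.
Proof.
move=> df y yr; have r0 : 0 < r by exact: le_lt_trans yr.
pose w n : V := \row_j (if (j < n)%N then y 0 j else x0 0 j).
have wr n : `|x0 - w n| < r.
  move: yr; rewrite !row_norm_lt // => /forallP yr; apply/forallP => j.
  have := yr j; rewrite !mxE; case: ifP => // _ _.
  by rewrite subrr normr0.
have wn n : (n <= N)%N -> f (w n) = f x0.
  elim: n => [|n IH] nN.
    by congr f; apply/rowP => j; rewrite !mxE.
  rewrite -(IH (ltnW nN)).
  pose i := Ordinal nN.
  have E : w n.+1 = (y 0 i - x0 0 i) *: evec R i + w n.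
    apply/rowP => j; rewrite !mxE ltnS /=.
    have [->|ji] := eqVneq j i.
      by rewrite /= leqnn ltnn mulr1 subrK.
    rewrite mulr0 add0r leq_eqVlt; have /negbTE -> // : (j : nat) != n.
    by move: ji; apply: contra => /eqP jn; apply/eqP/val_inj.
  have := wr n.+1; rewrite E => h; exact: line_const df (wr n) h.
rewrite -(wn N (leqnn N)); congr f; apply/rowP => j.
by rewrite !mxE ltn_ord.
Qed.

End LocallyConstant.

(** * Comparison of [u] with a positive Neumann solution *)

Section Comparison.
Variables (R : realType) (N M : nat) (O : set 'rV[R]_N).
Notation V := 'rV[R]_N.
Hypotheses (oO : open O) (Obox : in_box O M) (cO : compact (closure O))
  (O0 : O !=set0) (conO : connected O).
Hypothesis charts : forall x0, boundary O x0 ->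
  exists r phi, local_defining O x0 r phi.
Variables (a u v : V -> R) (q alpha : R).
Hypotheses (q01 : 0 < q < 1) (alpha0 : 0 <= alpha).
Hypotheses (ca : {within closure O, continuous a})
  (apos : exists x, O x /\ 0 < a x)
  (au : forall x, O x -> 0 < a x -> 0 < u x).
Hypotheses (solu : solution O a q alpha u)
  (vpos : positive_on_closure O v).

Variables (Du Lu Dv Lv : 'I_N -> V -> R).
Hypotheses (Hu : c2_data O u Du Lu) (Hv : c2_data O v Dv Lv).
Hypothesis u0 : forall x, closure O x -> 0 <= u x.
Hypothesis eqnu : forall x, O x -> \sum_i Lu i x = - (a x * u x `^ q).
Hypothesis eqnv : forall x, O x -> \sum_i Lv i x = - (a x * v x `^ q).
Hypothesis bdu : forall x0 r phi, boundary O x0 -> local_defining O x0 r phi ->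
  \sum_i Du i x0 * partial i phi x0
    = alpha * u x0 * Num.sqrt (\sum_i (partial i phi x0) ^+ 2).
Hypothesis bdv : forall x0 r phi, boundary O x0 -> local_defining O x0 r phi ->
  \sum_i Dv i x0 * partial i phi x0
    = 0 * v x0 * Num.sqrt (\sum_i (partial i phi x0) ^+ 2).

Let q0 : 0 < q. Proof. by case/andP: q01. Qed.
Let q1 : 0 < 1 - q. Proof. by rewrite subr_gt0; case/andP: q01. Qed.

(** Brings the quadratic term of [dflx] to the form [P^2 / A] required by [quotient_gap]. *)
Lemma sqr_flux (s D : R) : 0 < s ->
  s `^ (- q - 1) * D ^+ 2 = (s `^ (- q) * D) ^+ 2 / s `^ (1 - q).
Proof.
move=> s0; have sn : s != 0 by rewrite gt_eqF.
rewrite exprMn (expr2 (s `^ _)) -powRD ?sn ?implybT // mulrAC; congr (_ * _).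
rewrite -[(s `^ (1 - q))^-1]powRN -powRD ?sn ?implybT //; congr (_ `^ _); ring.
Qed.

Definition gap (e : R) x := pot q (v x) - pot q (u x + e).

Lemma gap_data (e : R) : 0 < e -> {within closure O, continuous (gap e)} /\
  forall x i, O x -> is_derive x (evec R i) (gap e)
    (flx q v Dv i x - flx q (fun x => u x + e) Du i x).
Proof.
move=> e0.
have ue x : closure O x -> 0 < u x + e by move=> cx; rewrite ltr_wpDl // u0.
have [cX dX] := pot_data q01 (c2_data_shift e Hu) ue.
have [cv dv] := pot_data q01 Hv vpos.
split; first exact: (@within_add _ _ O _ _ cv (@within_opp _ _ O _ cX)).
move=> x i Ox; have h1 := dX x i Ox; have h2 := dv x i Ox.
have -> : gap e = (pot q \o v) - (pot q \o (fun x => u x + e)) by [].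
by apply: is_derive_eq.
Qed.

Section Defect.
Variables (e m0 lam : R).
Hypothesis e0 : 0 < e.

Let X x := u x + e.
Let P i x := flx q v Dv i x.
Let Q i x := flx q X Du i x.

(** [P - Q] is the gradient of [gap e], so differentiating [psi] produces [- dpsi * (P - Q)^2]. The
    order [Q - P] makes the flux outward: [v] contributes nothing at the boundary and [u]
    contributes a multiple of [alpha >= 0]. *)
Definition comparison_field i x := psi lam m0 (gap e x) * (Q i x - P i x).
Definition comparison_div i x :=
  psi lam m0 (gap e x) * (dflx q X Du Lu i x - dflx q v Dv Lv i x)
  - dpsi lam m0 (gap e x) * (P i x - Q i x) ^+ 2.

Let Xpos x : closure O x -> 0 < X x.
Proof. by move=> cx; rewrite ltr_wpDl // u0. Qed.

Lemma comparison_c1 : c1_field O comparison_field comparison_div.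
Proof.
have [cg dg] := gap_data e0.
have [cQ cdQ dQ] := flx_c1 q (c2_data_shift e Hu) Xpos.
have [cP cdP dP] := flx_c1 q Hv vpos.
have cpsi : {within closure O, continuous (psi lam m0 \o gap e)}.
  apply: within_comp => // x cx.
  exact: derivable_continuous (is_derive_psi lam m0 _).
have cdpsi : {within closure O, continuous (dpsi lam m0 \o gap e)}.
  by apply: within_comp => // x cx; exact: dpsi_continuous.
split.
- by move=> i; apply: within_mul => //; apply: within_add => //; exact: within_opp.
- move=> i; apply: within_add.
    by apply: within_mul => //; apply: within_add => //; exact: within_opp.
  apply: within_opp; apply: within_mul => //; apply: within_mul;
    by apply: within_add => //; exact: within_opp.
- move=> x i Ox; have h1 := dQ x i Ox; have h2 := dP x i Ox.
  have h3 := is_derive_comp1 (is_derive_psi lam m0 _) (dg x i Ox).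
  have -> : comparison_field i = (psi lam m0 \o gap e)
    * (flx q X Du i - flx q v Dv i) by [].
  apply: is_derive_eq; rewrite /comparison_div /P /Q /GRing.scale /=.
  rewrite [(_ - _ : V -> R) x]/GRing.add /= [(- _ : V -> R) x]/GRing.opp /=.
  ring.
Qed.

Lemma comparison_outward : outward O comparison_field.
Proof.
move=> x0 r phi bx ch.
have -> : \sum_i comparison_field i x0 * partial i phi x0
  = psi lam m0 (gap e x0) *
    (X x0 `^ (- q) * (\sum_i Du i x0 * partial i phi x0)
     - v x0 `^ (- q) * (\sum_i Dv i x0 * partial i phi x0)).
  rewrite !mulr_sumr -sumrB mulr_sumr; apply: eq_bigr => i _.
  by rewrite /comparison_field /Q /P /flx; ring.
rewrite (bdu bx ch) (bdv bx ch) !mul0r mulr0 subr0 mulr_ge0 ?psi_ge0 //.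
rewrite mulr_ge0 ?powR_ge0 // mulr_ge0 ?sqrtr_ge0 // mulr_ge0 //.
by apply: u0; case: bx.
Qed.

(** Where [gap e x > m0], the quotients have denominators [A] and [B] with
    [A - B >= (1 - q) * m0 = m], and [quotient_gap] applies. Its positive term, multiplied by [q],
    has coefficient [4 * q / m = lam - 1]; hence [lam] absorbs it and one copy of [(P - Q)^2]
    survives. Elsewhere both sides are 0. *)
Lemma comparison_div_le (Ab : R) x : O x -> 0 < m0 -> 0 < Ab ->
  v x `^ (1 - q) <= Ab -> lam = 4 * q / ((1 - q) * m0) + 1 ->
  \sum_i comparison_div i x <= psi lam m0 (gap e x) *
    (relu (a x) * (1 - u x `^ q * (u x + e) `^ (- q))
     - \sum_i (q * ((1 - q) * m0) / (4 * Ab ^+ 2) * P i x ^+ 2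
               + (P i x - Q i x) ^+ 2)).
Proof.
move=> Ox m00 Ab0 vAb lamE; have cx := @subset_closure _ _ _ Ox.
have -> : \sum_i comparison_div i x = psi lam m0 (gap e x) *
    (\sum_i dflx q X Du Lu i x - \sum_i dflx q v Dv Lv i x)
    - dpsi lam m0 (gap e x) * \sum_i (P i x - Q i x) ^+ 2.
  by rewrite -sumrB !mulr_sumr -sumrB.
have [gm|gm] := leP (gap e x) m0.
  by have [-> ->] := psi_le0 lam gm; rewrite !mul0r subr0.
set m := (1 - q) * m0 in lamE *.
have mgt : 0 < m by rewrite mulr_gt0.
set A := v x `^ (1 - q) in vAb.
set B := X x `^ (1 - q).
have vx := vpos cx; have Xx := Xpos cx.
have A0 : 0 < A by rewrite powR_gt0.
have B0 : 0 < B by rewrite powR_gt0.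
have ABm : B + m <= A.
  move: gm; rewrite /gap /pot -/A -/B -mulrBl ltr_pdivlMr // => h.
  by rewrite /m; lra.
have S0 : 0 <= \sum_i (P i x - Q i x) ^+ 2 by apply: sumr_ge0 => i _; exact: sqr_ge0.
have p0 := psi_gt0 lam gm.
have dp := dpsi_ge lam m0 (gap e x).
apply: le_trans (_ : psi lam m0 (gap e x) * ((\sum_i dflx q X Du Lu i x - \sum_i dflx q v Dv Lv i x)
    - lam * \sum_i (P i x - Q i x) ^+ 2) <= _).
  rewrite [leRHS]mulrBr lerD2l lerN2 mulrA [_ * lam]mulrC; exact: ler_wpM2r.
rewrite ler_pM2l //.
rewrite !sum_dflx eqnu // eqnv //.
set rho := u x `^ q * _.
have -> : X x `^ (- q) * - (a x * u x `^ q) = - (a x * rho).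
  by rewrite /rho /X; ring.
have -> : v x `^ (- q) * - (a x * v x `^ q) = - a x.
  rewrite powRN; field; by rewrite gt_eqF // powR_gt0.
have -> : q * X x `^ (- q - 1) * \sum_i Du i x ^+ 2 = \sum_i q * (Q i x ^+ 2 / B).
  rewrite mulr_sumr; apply: eq_bigr => i _.
  by rewrite -mulrA sqr_flux.
have -> : q * v x `^ (- q - 1) * \sum_i Dv i x ^+ 2 = \sum_i q * (P i x ^+ 2 / A).
  rewrite mulr_sumr; apply: eq_bigr => i _.
  by rewrite -mulrA sqr_flux.
have [/andP[r1 r2] _] := rho_bounds q01 e0 (u0 cx).
rewrite -/rho in r1 r2.
have ra : a x * (1 - rho) <= relu (a x) * (1 - rho).
  by rewrite ler_wpM2r //; case: (reluP (a x)) => -[h ->].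
have term : \sum_i q * (P i x ^+ 2 / A) - \sum_i q * (Q i x ^+ 2 / B)
    - lam * \sum_i (P i x - Q i x) ^+ 2
   <= - \sum_i (q * m / (4 * Ab ^+ 2) * P i x ^+ 2 + (P i x - Q i x) ^+ 2).
  rewrite mulr_sumr -!sumrB -sumrN; apply: ler_sum => i _.
  have h := quotient_gap (P i x) (Q i x) mgt B0 ABm.
  have h1 : q * (P i x ^+ 2 / A - Q i x ^+ 2 / B) <=
     q * (4 / m * (P i x - Q i x) ^+ 2 - m / (4 * A ^+ 2) * P i x ^+ 2).
    by rewrite ler_pM2l.
  have h2 : q * m / (4 * Ab ^+ 2) * P i x ^+ 2 <= q * m / (4 * A ^+ 2) * P i x ^+ 2.
    rewrite ler_wpM2r ?sqr_ge0 // ler_pM2l ?mulr_gt0 //.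
    rewrite lef_pV2 ?posrE ?mulr_gt0 ?exprn_gt0 // ler_pM2l //.
    by apply: lerXn2r => //; rewrite nnegrE ltW.
  have -> : lam * (P i x - Q i x) ^+ 2 = q * (4 / m * (P i x - Q i x) ^+ 2) + (P i x - Q i x) ^+ 2.
    by rewrite lamE; field; rewrite gt_eqF.
  have h3 : q * (m / (4 * A ^+ 2) * P i x ^+ 2) = q * m / (4 * A ^+ 2) * P i x ^+ 2.
    by field; rewrite gt_eqF.
  rewrite !mulrBr h3 in h1; lra.
lra.
Qed.

End Defect.

(* Otherwise the Riemann sums of the right-hand side of [comparison_div_le] stay
   below a negative number for small [e], because the defect tends to 0. *)
Lemma gap_gradient (e1 m0 : R) x1 : 0 < e1 -> 0 < m0 -> O x1 ->
  m0 < gap e1 x1 -> forall i, Du i x1 = 0 /\ Dv i x1 = 0.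
Proof.
move=> e10 m00 Ox1 gx1.
have [cu cDu _ _] := Hu; have [cv cDv _ _] := Hv.
have [Ub Ub0 uU] := within_bounded cO cu.
have [Vb Vb0 vV] := within_bounded cO cv.
have uUb x : closure O x -> u x <= Ub by move=> /uU; exact: le_trans (ler_norm _).
have vVb x : closure O x -> v x <= Vb by move=> /vV; exact: le_trans (ler_norm _).
pose Ab := Vb `^ (1 - q); have Ab0 : 0 < Ab by rewrite powR_gt0.
pose m := (1 - q) * m0; have mgt : 0 < m by rewrite mulr_gt0.
pose lam := 4 * q / m + 1.
have lam0 : 0 < lam by rewrite addr_gt0 // divr_gt0 // mulr_gt0.
pose cm := q * m / (4 * Ab ^+ 2).
have cm0 : 0 < cm by rewrite divr_gt0 // ?mulr_gt0 // exprn_gt0.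
(* Chosen so that [p^2 + w^2 <= k0 * (cm * p^2 + (p - w)^2)], through [3 p^2 + 2 (p - w)^2 = p^2 +
   w^2 + (2 p - w)^2]. *)
pose k0 := 3 / cm + 2; have k00 : 0 < k0 by rewrite addr_gt0 // divr_gt0.
pose kv := Vb `^ (- q); have kv0 : 0 < kv by rewrite powR_gt0.
pose ku := (Ub + 1) `^ (- q).
have ku0 : 0 < ku by rewrite powR_gt0 // addr_gt0.
pose D x := \sum_i (kv ^+ 2 * Dv i x ^+ 2 + ku ^+ 2 * Du i x ^+ 2).
have Di0 x i : 0 <= kv ^+ 2 * Dv i x ^+ 2 + ku ^+ 2 * Du i x ^+ 2.
  by rewrite addr_ge0 // mulr_ge0 ?sqr_ge0.
have D0 x : 0 <= D x by apply: sumr_ge0 => i _; exact: Di0.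
(* A minorant free of [e]: for [e <= e1] the gap, hence [psi], can only grow, and for [e <= 1] the
   constants [kv] and [ku] bound [v^(-q)] and [(u + e)^(-q)] from below. *)
pose T x := psi lam m0 (gap e1 x) * (k0^-1 * D x).
have T0 x : O x -> 0 <= T x.
  by move=> _; rewrite mulr_ge0 ?psi_ge0 // mulr_ge0 // invr_ge0 ltW.
have cT : {for x1, continuous T}.
  apply: (interior_continuous oO _ Ox1); apply: within_mul.
    apply: (within_comp (f := gap e1) (g := psi lam m0)).
      by case: (gap_data e10).
    by move=> x cx; exact: derivable_continuous (is_derive_psi lam m0 _).
  apply: within_mul; first exact: within_cst.
  apply/subspace_continuousP => x cx; apply: cvg_sum => i.
  have cv2 := cDv i; have cu2 := cDu i.
  have : {within closure O, continuous (fun y => kv ^+ 2 * Dv i y ^+ 2 + ku ^+ 2 * Du i y ^+ 2)}.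
    by apply: within_add; apply: within_mul; (exact: within_cst || exact: within_mul).
  by move=> /subspace_continuousP; apply.
have [D1|D1] := eqVneq (D x1) 0.
  move=> i; move: D1 => /eqP; rewrite psumr_eq0 //.
  move=> /allP/(_ i); rewrite mem_index_enum => /(_ isT).
  have h1 : 0 <= kv ^+ 2 * Dv i x1 ^+ 2 by rewrite mulr_ge0 ?sqr_ge0.
  have h2 : 0 <= ku ^+ 2 * Du i x1 ^+ 2 by rewrite mulr_ge0 ?sqr_ge0.
  rewrite /= (paddr_eq0 h1 h2) (mulf_eq0 (kv ^+ 2)) (mulf_eq0 (ku ^+ 2)) !sqrf_eq0.
  by rewrite !(gt_eqF kv0) !(gt_eqF ku0) /= => /andP[/eqP -> /eqP ->].
exfalso.
have Tx1 : 0 < T x1.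
  rewrite mulr_gt0 ?psi_gt0 // mulr_gt0 ?invr_gt0 //.
  by rewrite lt_def D1 D0.
have [c c0 cP] := rsum_lower oO Obox T0 Ox1 cT Tx1.
(* [gap e x <= pot q Vb] because [pot] is nonnegative, so [Psi] bounds the weight of the defect for
   every [e]. *)
pose Psi := psi lam m0 (pot q Vb) + 1.
have Psi0 : 0 < Psi by rewrite ltr_wpDl // psi_ge0.
have c4 : 0 < c / 4 by rewrite divr_gt0.
have c4P : 0 < c / 4 / Psi by rewrite divr_gt0.
have [e0 e00 e0P] := rho_defect M oO cO charts q01 ca au solu c4P.
pose e := Num.min e0 (Num.min e1 1).
have egt : 0 < e by rewrite !lt_min e00 e10 ltr01.
have ele1 : e <= e1 by rewrite /e !ge_min lexx orbT.
have e1le : e <= 1 by rewrite /e !ge_min lexx !orbT.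
have dP : \forall k \near \oo,
    rsum M (fun x => \1_O x * (relu (a x) * (1 - u x `^ q * (u x + e) `^ (- q)))) k <= c / 4 / Psi.
  by apply: e0P; rewrite egt ge_min lexx.
have divP : \forall k \near \oo, - (c / 4) <=
    dyadic_sum O (fun x => \sum_i comparison_div e m0 lam i x) M k.
  apply: (@divergence_ge0 _ _ M O oO Obox cO O0 charts (comparison_field e m0 lam)) => //.
    exact: comparison_c1.
  exact: comparison_outward.
have pt x : \1_O x * (\sum_i comparison_div e m0 lam i x) <=
   Psi * (\1_O x * (relu (a x) * (1 - u x `^ q * (u x + e) `^ (- q))))
   - \1_O x * T x.
  have [Ox|nOx] := pselect (O x); last by rewrite indicE memNset // !mul0r mulr0 subr0.
  rewrite indicE mem_set // !mul1r.
  have cx := @subset_closure _ _ _ Ox.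
  have vx := vpos cx.
  have Xx : 0 < u x + e by rewrite ltr_wpDl // u0.
  have vA : v x `^ (1 - q) <= Ab.
    by apply: powR_homo; rewrite ?(ltW q1) ?(ltW vx) // vVb.
  apply: le_trans (comparison_div_le egt Ox m00 Ab0 vA (erefl _)) _.
  have [/andP[r1 r2] _] := rho_bounds q01 egt (u0 cx).
  set W := relu (a x) * _.
  have W0 : 0 <= W by rewrite mulr_ge0 //; case: (reluP (a x)) => -[h ->].
  rewrite mulrBr; apply: lerB.
    rewrite ler_wpM2r // /Psi; apply: le_trans (_ : psi lam m0 (pot q Vb) <= _); last by rewrite lerDl.
    apply: psi_homo => //; rewrite /gap lerBlDr; apply: le_trans (_ : pot q Vb <= _).
      by apply: pot_homo => //; [exact: ltW|exact: vVb].
    by rewrite lerDl divr_ge0 ?powR_ge0 // ltW.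
  apply: ler_pM; rewrite ?psi_ge0 //.
  - by rewrite mulr_ge0 // invr_ge0 ltW.
  - apply: psi_homo => //; rewrite /gap lerD2l lerN2; apply: pot_homo => //.
      exact: ltW.
    by rewrite lerD2l.
  rewrite mulrC ler_pdivrMr // mulr_suml; apply: ler_sum => i _.
  rewrite -/m -/cm.
  set p := flx q v Dv i x; set w := flx q _ Du i x.
  have h1 : kv ^+ 2 * Dv i x ^+ 2 <= p ^+ 2.
    rewrite /p /flx [leRHS]exprMn ler_wpM2r ?sqr_ge0 //.
    apply: lerXn2r; rewrite ?nnegrE ?powR_ge0 //.
    by apply: powRN_homo => //; exact: vVb.
  have h2 : ku ^+ 2 * Du i x ^+ 2 <= w ^+ 2.
    rewrite /w /flx [leRHS]exprMn ler_wpM2r ?sqr_ge0 //.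
    apply: lerXn2r; rewrite ?nnegrE ?powR_ge0 //.
    by apply: powRN_homo => //; rewrite lerD // uUb.
  have h3 : p ^+ 2 + w ^+ 2 <= (cm * p ^+ 2 + (p - w) ^+ 2) * k0.
    have -> : (cm * p ^+ 2 + (p - w) ^+ 2) * k0
      = 3 * p ^+ 2 + 2 * (p - w) ^+ 2 + 2 * cm * p ^+ 2 + 3 / cm * (p - w) ^+ 2.
      by rewrite /k0; field; rewrite gt_eqF.
    have h4 : 0 <= 2 * cm * p ^+ 2.
      by apply: mulr_ge0; [rewrite mulr_ge0 // ltW|exact: sqr_ge0].
    have h5 : 0 <= 3 / cm * (p - w) ^+ 2.
      by apply: mulr_ge0; [rewrite divr_ge0 // ltW|exact: sqr_ge0].
    have h6 : 0 <= (2 * p - w) ^+ 2 by exact: sqr_ge0.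
    have -> : 3 * p ^+ 2 + 2 * (p - w) ^+ 2 = p ^+ 2 + w ^+ 2 + (2 * p - w) ^+ 2.
      by ring.
    lra.
  lra.
near \oo => k.
have g1 : c <= rsum M (fun x => \1_O x * T x) k by near: k.
have g2 : rsum M (fun x => \1_O x * (relu (a x) * (1 - u x `^ q * (u x + e) `^ (- q)))) k <= c / 4 / Psi.
  by near: k.
have g3 : - (c / 4) <= dyadic_sum O (fun x => \sum_i comparison_div e m0 lam i x) M k by near: k.
rewrite dyadic_sumE in g3; have := le_trans g3 (ler_rsum M k pt).
rewrite rsumB rsumZ; move: g2; rewrite ler_pdivlMr // [_ * Psi]mulrC => g2; lra.
Unshelve. all: by end_near. Qed.

Lemma comparison x1 : O x1 -> v x1 <= u x1.
Proof.
move=> Ox1; rewrite leNgt; apply/negP => uv.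
have [cu cDu _ du] := Hu; have [cv cDv _ dv] := Hv.
(* Half the difference keeps [u x1 + e1 < v x1], so the gap at [x1] is positive and exceeds its half
   [m0]. *)
pose e1 := (v x1 - u x1) / 2.
have e10 : 0 < e1 by rewrite divr_gt0 // subr_gt0.
pose m0 := gap e1 x1 / 2.
have g0 : 0 < gap e1 x1.
  rewrite subr_gt0; apply: pot_lt => //; last by rewrite /e1; lra.
  by rewrite ltr_wpDl // u0 //; exact: subset_closure.
have m00 : 0 < m0 by rewrite divr_gt0.
have mg : m0 < gap e1 x1 by rewrite /m0; lra.
(* On this joint level set the gap keeps its value at [x1], so it exceeds [m0] on a ball around each
   point of [Z]. Both gradients vanish there, which makes [Z] open; continuity makes it closed in
   [O]. *)
pose Z := O `&` [set x | u x = u x1 /\ v x = v x1].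
have Zgap x : Z x -> gap e1 x = gap e1 x1.
  by move=> [_ [ux vx]]; rewrite /gap ux vx.
have cont (f : V -> R) x : {within closure O, continuous f} -> O x -> {for x, continuous f}.
  by move=> cf Ox; exact: (interior_continuous oO cf Ox).
have nearZ x : Z x -> exists2 r : R, 0 < r & forall y, `|x - y| < r ->
    O y /\ m0 < gap e1 y.
  move=> Zx; have Ox := Zx.1.
  have [cg _] := gap_data e10.
  have gm : 0 < gap e1 x - m0 by rewrite subr_gt0 Zgap.
  have /continuousP_dist/(_ _ gm)[r r0 rP] := cont _ _ cg Ox.
  have /near_ballP[r' r'0 r'P] : nbhs x O by exact: open_nbhs_nbhs.
  exists (Num.min r r'); first by rewrite lt_min r0.
  move=> y; rewrite lt_min => /andP[/rP + /r'P Oy].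
  by rewrite ltr_norml => /andP[h1 h2]; split => //; lra.
have oZ : open Z.
  rewrite openE => x Zx; have [r r0 rP] := nearZ x Zx.
  apply/near_ballP; exists r => // y xy.
  have dfu z j : `|x - z| < r -> is_derive z (evec R j) u 0.
    move=> /rP[Oz gz]; have [h _] := du z j Oz.
    by have [<- _] := gap_gradient e10 m00 Oz gz j.
  have dfv z j : `|x - z| < r -> is_derive z (evec R j) v 0.
    move=> /rP[Oz gz]; have [h _] := dv z j Oz.
    by have [_ <-] := gap_gradient e10 m00 Oz gz j.
  have [_ [ux vx]] := Zx.
  split; first by have [] := rP y xy.
  by rewrite /= (ball_const dfu xy) (ball_const dfv xy) ux vx.
have oZ' : open (O `\` Z).
  rewrite openE => x [Ox nZ].
  have sep (f : V -> R) : {within closure O, continuous f} -> f x <> f x1 ->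
      nbhs x [set y | f y <> f x1].
    move=> cf /eqP fx; have fx' : 0 < `|f x - f x1| by rewrite normr_gt0 subr_eq0.
    have /continuousP_dist/(_ _ fx')[r r0 rP] := cont _ _ cf Ox.
    by apply/near_ballP; exists r => // y /rP + fy; rewrite fy ltxx.
  have nO : nbhs x O by exact: open_nbhs_nbhs.
  have [ux|ux] := pselect (u x = u x1); last first.
    by apply: filterS (filterI nO (sep u cu ux)) => y [Oy uy]; split => // -[_ []].
  have vx : v x <> v x1 by move=> vx; apply: nZ.
  by apply: filterS (filterI nO (sep v cv vx)) => y [Oy vy]; split => // -[_ []].
have ZO : Z = O.
  apply: conO.
  - by exists x1.
  - by exists Z => //; apply/seteqP; split => x; [move=> Zx; split => //; exact: Zx.1|case].
  - exists (~` (O `\` Z)); first exact: open_closedC.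
    apply/seteqP; split => x; first by move=> Zx; split; [exact: Zx.1|case].
    by move=> [Ox nx]; apply: contrapT => nZ; apply: nx.
have [x [Ox ax]] := apos.
have Dv0 i y : O y -> Dv i y = 0.
  move=> Oy; have Zy : Z y by rewrite ZO.
  by have [] := @gap_gradient e1 m0 y e10 m00 Oy _ i; rewrite // Zgap.
have := eqnv Ox; rewrite big1 => [/esym/eqP|i _]; last first.
  by apply: (second_derive_zero Hv oO) => // y; exact: Dv0.
rewrite oppr_eq0 mulf_eq0 !gt_eqF // powR_gt0 // vpos //.
exact: subset_closure.
Qed.

End Comparison.

(** * From the hypotheses on the domain and on [a] to the theorem *)

Section SmoothDomain.
Variables (R : realType) (N : nat).
Implicit Types (O : set 'rV[R]_N).

Lemma bounded_cball O : bounded_set O ->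
  exists2 r : R, 0 < r & forall x, O x -> `|x| <= r.
Proof.
move=> [M [Mreal MO]]; exists (Num.max M 0 + 1).
  by rewrite ltr_wpDl // le_max lexx orbT.
by apply: MO; rewrite ltr_pwDr // le_max lexx.
Qed.

Lemma bounded_closure_compact O : bounded_set O -> compact (closure O).
Proof.
move=> /bounded_cball[r r0 rO].
have cB := @compact_cball R N 0 r.
apply: (subclosed_compact _ cB); first exact: closed_closure.
have : closed [set y : 'rV[R]_N | `|0 - y| <= r].
  by apply: compact_closed => //; exact: norm_hausdorff.
rewrite closure_id => ->; apply: closureS => x /rO.
by rewrite /= sub0r normrN.
Qed.

Lemma bounded_in_box O : bounded_set O -> exists M, in_box O M.
Proof.
move=> /bounded_cball[r r0 rO]; exists (Num.trunc r).+1 => x i /rO xr.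
rewrite -ler_norml; apply: le_trans (coord_le_norm x i) _.
by apply: le_trans xr _; apply: ltW; exact: truncnS_gt.
Qed.

Lemma holder_continuous (t : R) O (f : 'rV[R]_N -> R) : 0 < t ->
  holder_on t O f -> {within O, continuous f}.
Proof.
move=> t0 [C fC]; apply/subspace_continuousP => x Ox.
apply/(within_cvgP O f x) => e e0.
(* The Hölder constant may have any sign or be 0. The radius [s^(1/t)] solves [radius^t = s]. *)
have C1 : 0 < `|C| + 1 by rewrite ltr_wpDl.
pose s := e / (`|C| + 1); have s0 : 0 < s by rewrite divr_gt0.
exists (s `^ t^-1); first exact: powR_gt0.
move=> y Oy xy; apply: le_lt_trans (fC x y Ox Oy) _.
have h : `|x - y| `^ t <= s.
  apply: le_trans (_ : (s `^ t^-1) `^ t <= _).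
    by apply: powR_homo => //; exact: ltW.
  by rewrite -powRrM mulVf ?gt_eqF // powRr1 // ltW.
apply: le_lt_trans (_ : `|C| * s < _).
  apply: le_trans (_ : `|C| * `|x - y| `^ t <= _).
    by rewrite ler_wpM2r ?powR_ge0 // ler_norm.
  exact: ler_wpM2l.
by rewrite /s mulrA ltr_pdivrMr // mulrC ltr_pM2l // ltrDl.
Qed.

End SmoothDomain.

Theorem theorem1p1 (R : realType) (N : nat) (Omega : set 'rV[R]_N)
  (theta : R) (a : 'rV[R]_N -> R) (alpha q : R) (u : 'rV[R]_N -> R) :
  (1 <= N)%N ->
  smooth_domain Omega ->
  0 < theta < 1 ->
  holder_on theta (closure Omega) a ->
  (exists x, Omega x /\ 0 < a x) -> (exists x, Omega x /\ a x < 0) ->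
  0 <= alpha -> 0 < q < 1 ->
  solution Omega a q alpha u ->
  (forall x, pos_part Omega a x -> 0 < u x) ->
  (forall M : nat, in_box Omega M -> integral_over Omega a M < 0) /\
  (finite_set (components (pos_part Omega a)) ->
   (forall C, components (pos_part Omega a) C -> smooth_domain C) ->
   I_N Omega a q ->
   positive_on_closure Omega u).
Proof.
move=> _ [oO [neO [conO [bO charts]]]] /andP[theta0 _] hold apos _ alpha0 q01 sol upos.
have cO := bounded_closure_compact bO.
have ca := holder_continuous theta0 hold.
have au x : Omega x -> 0 < a x -> 0 < u x by move=> Ox ax; exact: upos.
split=> [M Obox | _ _ [_ [v [solv vpos]]]].
  exact: (integral_over_lt0 oO Obox cO neO charts q01 alpha0 ca apos au sol).
have [M Obox] := bounded_in_box bO.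
have [Du [Lu [Hu u0 eqnu bdu]]] := solution_data sol.
have [Dv [Lv [Hv _ eqnv bdv]]] := solution_data solv.
have uv : forall x, closure Omega x -> 0 <= u x + - v x.
  apply: closure_ge0.
    by case: Hu Hv => cu _ _ _ [cv _ _ _]; exact: within_add cu (within_opp cv).
  move=> x Ox; rewrite subr_ge0.
  exact: (comparison oO Obox cO neO conO charts q01 alpha0 ca apos au sol vpos
    Hu Hv u0 eqnu eqnv bdu bdv Ox).
by move=> x cx; apply: lt_le_trans (vpos x cx) _; rewrite -subr_ge0 uv.
Qed.
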